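(* Let $\alpha\in\mathbb T$ and let $\mathcal V_\alpha:L^2(\mu)\to L^2(\mu_\alpha)$ be a unitary operator with $\mathcal V_\alpha U_\alpha=M_z\mathcal V_\alpha$ and $\mathcal V_\alpha\mathbf 1=\mathbf 1$. Then for all $f\in C^1(\mathbb T)$, $$\mathcal V_\alpha f(z)=f(z)+(1-\alpha)\int_{\mathbb T}\frac{f(\xi)-f(z)}{1-\overline\xi z}\,d\mu(\xi)\qquad(\mu_\alpha\text{-a.e. }z),$$ where the integrand at $\xi=z$ is defined by continuity.
   Context: $\mathbb T=\{z\in\mathbb C:|z|=1\}$. Let $\mu$ be a Borel probability measure on $\mathbb T$, $U=M_\xi$ multiplication by the independent variable $\xi$ on $L^2(\mu)$, $b=\mathbf 1$ and $b_1=U^*b$ (so $b_1(\xi)=\overline\xi$). For $\alpha\in\mathbb C$ put $U_\alpha=U+(\alpha-1)(\,\cdot\,,b_1)_{L^2(\mu)}b$, i.e. $(U_\alpha f)(\xi)=\xi f(\xi)+(\alpha-1)\int_{\mathbb T}f(\zeta)\zeta\,d\mu(\zeta)$. For $\alpha\in\mathbb T$, $U_\alpha$ is unitary with $*$-cyclic vector $b$, and $\mu_\alpha$ denotes its spectral measure with respect to $b$, i.e. the probability measure on $\mathbb T$ with $\int_{\mathbb T}z^n\,d\mu_\alpha(z)=(U_\alpha^nb,b)_{L^2(\mu)}$ for all $n\in\mathbb Z$. $M_z$ denotes multiplication by the independent variable $z$ on $L^2(\mu_\alpha)$. *)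

(* Defs.v *)
From HB Require Import structures.
From mathcomp Require Import all_boot all_order all_algebra.
From mathcomp Require Import all_classical all_reals all_analysis.
From mathcomp Require Import complex.

Set Implicit Arguments.
Unset Strict Implicit.
Unset Printing Implicit Defensive.

Import Order.TTheory GRing.Theory Num.Theory.
Import numFieldNormedType.Exports.
Local Open Scope classical_set_scope.
Local Open Scope ring_scope.

(* The unit circle T is parametrized by the angle: a point of T is expi t,
   t in [0, 2pi[.  Borel probability measures on T are represented by
   probability measures on the Borel sets of R concentrated on [0, 2pi[,
   and functions on T by functions of the angle. *)

Section defs.
Variable R : realType.

Definition expi (t : R) : R[i] := Complex (cos t) (sin t).

Definition angles : set R := `[0, pi *+ 2[%classic.

Definition on_circle (mu : {measure set R -> \bar R}) : Prop :=
  mu (~` angles) = 0%E.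

Definition cint (mu : {measure set R -> \bar R}) (f : R -> R[i]) : R[i] :=
  Complex (\int[mu]_(x in setT) complex.Re (f x))%R
          (\int[mu]_(x in setT) complex.Im (f x))%R.

Definition sqnormc (z : R[i]) : R := complex.Re z ^+ 2 + complex.Im z ^+ 2.

Definition L2 (mu : {measure set R -> \bar R}) (f : R -> R[i]) : Prop :=
  [/\ measurable_fun setT (fun x => complex.Re (f x)),
      measurable_fun setT (fun x => complex.Im (f x)) &
      mu.-integrable setT (fun x => (sqnormc (f x))%:E)].

Definition ip (mu : {measure set R -> \bar R}) (f g : R -> R[i]) : R[i] :=
  cint mu (fun x => f x * conjc (g x)).

Definition Ualpha (mu : {measure set R -> \bar R}) (alpha : R[i])
    (f : R -> R[i]) : R -> R[i] :=
  fun t => expi t * f t + (alpha - 1) * cint mu (fun s => f s * expi s).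

(* adjoint: U_alpha^* g (xi) = conj(xi) g(xi) + (conj(alpha) - 1) (int g dmu) conj(xi);
   for alpha in T it is the inverse of U_alpha, so U_alpha^(-n) = (U_alpha^* )^n *)
Definition Ualpha_adj (mu : {measure set R -> \bar R}) (alpha : R[i])
    (g : R -> R[i]) : R -> R[i] :=
  fun t => conjc (expi t) * g t
           + (conjc alpha - 1) * cint mu g * conjc (expi t).

Definition onec : R -> R[i] := fun _ => 1.

(* mua is the spectral measure of U_alpha w.r.t. b = 1:
   int z^n dmua = (U_alpha^n b, b) for all n in Z *)
Definition is_spectral_measure (mu mua : {measure set R -> \bar R})
    (alpha : R[i]) : Prop :=
  mua setT = 1%E /\ on_circle mua /\
  forall n : nat,
    cint mua (fun t => expi t ^+ n) = ip mu (iter n (Ualpha mu alpha) onec) onec /\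
    cint mua (fun t => conjc (expi t) ^+ n)
      = ip mu (iter n (Ualpha_adj mu alpha) onec) onec.

(* V : L^2(mu) -> L^2(mua) unitary, given on representatives *)
Definition unitary_L2 (mu mua : {measure set R -> \bar R})
    (V : (R -> R[i]) -> (R -> R[i])) : Prop :=
  [/\ (forall f, L2 mu f -> L2 mua (V f)),
      (forall f g, L2 mu f -> L2 mu g -> {ae mu, forall x, f x = g x} ->
          {ae mua, forall x, V f x = V g x}),
      (forall f g (c : R[i]), L2 mu f -> L2 mu g ->
          {ae mua, forall x, V (fun y => f y + c * g y) x = V f x + c * V g x}),
      (forall f, L2 mu f -> ip mua (V f) (V f) = ip mu f f) &
      (forall g, L2 mua g -> exists f, L2 mu f /\ {ae mua, forall x, V f x = g x})].

Definition C1_circle (f : R -> R[i]) : Prop :=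
  (forall t, f (t + pi *+ 2) = f t) /\
  (forall t, derivable (fun s => complex.Re (f s)) t 1) /\
  (forall t, derivable (fun s => complex.Im (f s)) t 1) /\
  continuous (fun x : R => (derive1 (fun s : R => complex.Re (f s)) x : R)) /\
  continuous (fun x : R => (derive1 (fun s : R => complex.Im (f s)) x : R)).

Definition dangle (f : R -> R[i]) (t : R) : R[i] :=
  Complex (derive1 (fun s => complex.Re (f s)) t)
          (derive1 (fun s => complex.Im (f s)) t).

(* kernel (f(xi) - f(z)) / (1 - conj(xi) z), xi = expi s, z = expi t,
   extended by continuity on the diagonal xi = z, where its limit is
   -i * (d/dtheta f)(t)  *)
Definition ckernel (f : R -> R[i]) (s t : R) : R[i] :=
  if expi s == expi t then - Complex 0 1 * dangle f t
  else (f s - f t) / (1 - conjc (expi s) * expi t).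

End defs.

(* Main.v *)
Require Import Defs.
From HB Require Import structures.
From mathcomp Require Import all_boot all_order all_algebra.
From mathcomp Require Import all_classical all_reals all_analysis.
From mathcomp Require Import complex.
From mathcomp Require Import measurable_realfun ring lra zify.

Set Implicit Arguments.
Unset Strict Implicit.
Unset Printing Implicit Defensive.

Import Order.TTheory GRing.Theory Num.Theory.
Import numFieldNormedType.Exports.
Local Open Scope classical_set_scope.
Local Open Scope ring_scope.

(* V maps 1 to 1 and turns U_alpha into multiplication by z; since U_alpha f
   differs from xi f by a constant, V (xi f) and z V f differ by an explicit
   constant.  The right-hand side of the formula obeys the same recursion, so
   both sides agree on trigonometric polynomials.  A C^1 function f is
   approximated by trigonometric polynomials p with f - p and f' - p'
   uniformly small: apply a discretized Fejer kernel to f' and integrate.  The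
   kernel of f - p is then uniformly small, so the right-hand side converges
   uniformly, while V p converges to V f in L^2. *)

(** * Complex numbers and the exponential *)

(** The right-hand side contains a difference quotient of [f], which uniform closeness of [p] to [f]
    does not control; closeness of the derivatives does, since a chord of the circle is comparable
    to its shorter arc. Hence the approximation is made at the level of [f']. Averaging over equally
    spaced nodes replaces convolution by a finite sum that is visibly a trigonometric polynomial,
    and the orthogonality it needs is exact because every frequency involved is smaller than the
    number of nodes. In the limit, uniform convergence on one side meets [L2] convergence on the
    other. Instead of extracting an almost everywhere convergent subsequence, the squared defect
    [sqnormc (V f t - clark_repr mu alpha f t)] is dominated, for every [eps], by a measurable
    function of integral at most [eps]. Only these majorants have to be measurable, so the
    dependence of the right-hand side on [t] needs no measurability proof. *)

Lemma ReD (R : realType) (z w : R[i]) :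
  complex.Re (z + w) = complex.Re z + complex.Re w.
Proof. by case: z; case: w. Qed.

Lemma ImD (R : realType) (z w : R[i]) :
  complex.Im (z + w) = complex.Im z + complex.Im w.
Proof. by case: z; case: w. Qed.

Lemma ReN (R : realType) (z : R[i]) : complex.Re (- z) = - complex.Re z.
Proof. by case: z. Qed.

Lemma ImN (R : realType) (z : R[i]) : complex.Im (- z) = - complex.Im z.
Proof. by case: z. Qed.

Lemma ReM (R : realType) (z w : R[i]) : complex.Re (z * w) =
  complex.Re z * complex.Re w - complex.Im z * complex.Im w.
Proof. by case: z; case: w. Qed.

Lemma ImM (R : realType) (z w : R[i]) : complex.Im (z * w) =
  complex.Re z * complex.Im w + complex.Im z * complex.Re w.
Proof. by case: z; case: w. Qed.

Lemma ReJ (R : realType) (z : R[i]) : complex.Re (conjc z) = complex.Re z.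
Proof. by case: z. Qed.

Lemma ImJ (R : realType) (z : R[i]) : complex.Im (conjc z) = - complex.Im z.
Proof. by case: z. Qed.

Lemma Re1 (R : realType) : complex.Re (1 : R[i]) = 1. Proof. by []. Qed.
Lemma Im1 (R : realType) : complex.Im (1 : R[i]) = 0. Proof. by []. Qed.
Lemma Re0 (R : realType) : complex.Re (0 : R[i]) = 0. Proof. by []. Qed.
Lemma Im0 (R : realType) : complex.Im (0 : R[i]) = 0. Proof. by []. Qed.

Definition ReImE := (ReD, ImD, ReN, ImN, ReM, ImM, ReJ, ImJ, Re1, Im1, Re0, Im0).

Lemma complex_ext (R : realType) (z w : R[i]) :
  complex.Re z = complex.Re w -> complex.Im z = complex.Im w -> z = w.
Proof. by case: z; case: w => a b c d /= -> ->. Qed.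

Lemma Re_sum (R : realType) n (F : 'I_n -> R[i]) :
  complex.Re (\sum_i F i) = \sum_i complex.Re (F i).
Proof. by apply: (big_morph (@complex.Re R)) => // z w; exact: ReD. Qed.

Lemma conjc_sum (R : realType) n (F : 'I_n -> R[i]) :
  conjc (\sum_i F i) = \sum_i conjc (F i).
Proof.
apply: (big_morph (@conjc R)); last by apply: complex_ext; rewrite !ReImE ?oppr0.
by move=> z w; apply: complex_ext; rewrite !ReImE ?opprD.
Qed.

Lemma sqnormc_ge0 (R : realType) (z : R[i]) : 0 <= sqnormc z.
Proof. by rewrite addr_ge0 ?sqr_ge0. Qed.

Lemma sqnormcM (R : realType) (z w : R[i]) :
  sqnormc (z * w) = sqnormc z * sqnormc w.
Proof. by rewrite /sqnormc !ReImE; ring. Qed.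

Lemma sqnormcJ (R : realType) (z : R[i]) : sqnormc (conjc z) = sqnormc z.
Proof. by rewrite /sqnormc !ReImE sqrrN. Qed.

Lemma sqnormcN (R : realType) (z : R[i]) : sqnormc (- z) = sqnormc z.
Proof. by rewrite /sqnormc !ReImE !sqrrN. Qed.

Lemma sqnormc_eq0 (R : realType) (z : R[i]) : (sqnormc z == 0) = (z == 0).
Proof. by rewrite eq_complex paddr_eq0 ?sqr_ge0// !sqrf_eq0. Qed.

Lemma sqnormcD_le (R : realType) (z w : R[i]) :
  sqnormc (z + w) <= 2 * (sqnormc z + sqnormc w).
Proof.
rewrite /sqnormc !ReImE; set a := complex.Re z; set b := complex.Re w.
set c := complex.Im z; set d := complex.Im w.
have := sqr_ge0 (a - b); have := sqr_ge0 (c - d); nra.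
Qed.

Lemma sqnormcE (R : realType) (z : R[i]) : sqnormc z = complex.Re (z * conjc z).
Proof. by rewrite /sqnormc !ReImE mulrN opprK !expr2. Qed.

Lemma sqnormc_bnd (R : realType) (z : R[i]) (e : R) :
  `|complex.Re z| <= e -> `|complex.Im z| <= e -> sqnormc z <= 2 * e ^+ 2.
Proof.
by rewrite !ler_norml => /andP[? ?] /andP[? ?]; rewrite /sqnormc; nra.
Qed.

Lemma ReIm_le_sqnormc (R : realType) (z : R[i]) (e : R) : 0 <= e ->
  sqnormc z <= e ^+ 2 -> `|complex.Re z| <= e /\ `|complex.Im z| <= e.
Proof.
move=> e0; rewrite /sqnormc => h.
have := sqr_ge0 (complex.Re z); have := sqr_ge0 (complex.Im z) => h1 h2.
by split; rewrite -ler_sqr ?nnegrE// real_normK ?num_real//; lra.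
Qed.

Lemma expiD (R : realType) (s t : R) : expi (s + t) = expi s * expi t.
Proof.
by apply: complex_ext; rewrite !ReImE /= ?cosD ?sinD// addrC; congr (_ + _).
Qed.

Lemma expi0 (R : realType) : expi 0 = 1 :> R[i].
Proof. by rewrite /expi cos0 sin0. Qed.

Lemma expiN (R : realType) (t : R) : expi (- t) = conjc (expi t).
Proof. by rewrite /expi cosN sinN. Qed.

Lemma expi_mulJ (R : realType) (t : R) : expi t * conjc (expi t) = 1.
Proof. by rewrite -expiN -expiD subrr expi0. Qed.

Lemma sqnormc_expi (R : realType) (t : R) : sqnormc (expi t) = 1.
Proof. by rewrite sqnormcE expi_mulJ. Qed.

Lemma expi_neq0 (R : realType) (t : R) : expi t != 0.
Proof. by rewrite -sqnormc_eq0 sqnormc_expi oner_eq0. Qed.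

Lemma expi_mulrn (R : realType) (t : R) n : expi (n%:R * t) = expi t ^+ n.
Proof.
elim: n => [|n IH]; first by rewrite mul0r expi0 expr0.
by rewrite -natr1 mulrDl mul1r expiD IH exprSr.
Qed.

Lemma expi_2pi (R : realType) : expi (pi *+ 2) = 1 :> R[i].
Proof. by rewrite /expi -[pi *+ 2]add0r cosD2pi sinD2pi cos0 sin0. Qed.

Lemma expi_2pi_int (R : realType) (m : int) : expi (m%:~R * (pi *+ 2)) = 1 :> R[i].
Proof.
case: m => n; first by rewrite expi_mulrn expi_2pi expr1n.
rewrite NegzE rmorphN mulNr expiN expi_mulrn expi_2pi expr1n.
by apply: complex_ext; rewrite !ReImE ?oppr0.
Qed.

(** Cosine is injective only on [[0, pi]], so a value of [|t|] beyond [pi] is reflected to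
    [2 pi - |t|]; the strict bound on [|t|] forbids that this reflected angle be 0. *)
Lemma expi_eq1 (R : realType) (t : R) :
  `|t| < pi *+ 2 -> expi t = 1 -> t = 0.
Proof.
move=> tpi te.
have {te}: cos `|t| = 1 by move: te => [+ _]; case: (ler0P t) => // _; rewrite ?cosN.
move: tpi; set u := `|t|; rewrite mulr2n => tpi cu.
have u0 : 0 <= u := normr_ge0 t.
have pi0 : 0 < pi :> R := pi_gt0 R.
suff : u = 0 by move/normr0_eq0.
have [upi|upi] := leP u pi.
  by apply: (@cos_inj R); rewrite ?in_itv/= ?lexx ?u0 ?upi ?cos0 ?cu// ltW.
have : pi + pi - u = 0.
  apply: (@cos_inj R); rewrite ?in_itv/= ?cos0.
  - by apply/andP; split; lra.
  - by rewrite lexx ltW.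
  - by rewrite -mulr2n addrC cosD2pi cosN.
by lra.
Qed.

(** Discrete orthogonality: up to a unimodular factor this is a geometric sum in the [M]-th root of
    unity [x], and [0 < |m| < M] keeps [x] away from 1. *)
Lemma sum_expi_eq0 (R : realType) (M : nat) (m : int) (t : R) :
  m != 0 -> `|m|%R < M%:Z ->
  \sum_(j < M) expi (m%:~R * (t - (pi *+ 2) * j%:R / M%:R)) = 0.
Proof.
move=> m0 mM; have M0 : (M%:R : R) != 0.
  by rewrite pnatr_eq0; apply: contraTneq mM => ->; rewrite -leNgt.
pose x : R[i] := expi (- m%:~R * (pi *+ 2) / M%:R).
have -> : \sum_(j < M) expi (m%:~R * (t - (pi *+ 2) * j%:R / M%:R)) =
    expi (m%:~R * t) * \sum_(j < M) x ^+ j.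
  rewrite big_distrr; apply: eq_bigr => j _ /=.
  by rewrite -expi_mulrn -expiD; congr expi; ring.
have xM : x ^+ M = 1.
  rewrite -expi_mulrn mulrC mulfVK// -rmorphN; exact: expi_2pi_int.
suff /eqP : (x - 1) * \sum_(j < M) x ^+ j = 0.
  rewrite mulf_eq0 => /orP[|/eqP ->]; last by rewrite mulr0.
  rewrite subr_eq0 => /eqP /expi_eq1 H; exfalso.
  have pi0 : 0 < (pi *+ 2 : R) by rewrite pmulrn_lgt0// pi_gt0.
  suff : - m%:~R * (pi *+ 2) / M%:R = 0 :> R.
    by apply/eqP; rewrite mulf_neq0 ?invr_eq0// mulf_neq0 ?(gt_eqF pi0)//
      oppr_eq0 intr_eq0.
  have MR0 : 0 < (M%:R : R) by rewrite lt_neqAle eq_sym M0 ler0n.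
  apply: H; rewrite !normrM normrN normfV (gtr0_norm MR0) (gtr0_norm pi0).
  rewrite ltr_pdivrMr// mulrC ltr_pM2l// -intr_norm.
  by rewrite -[M%:R]/(M%:Z%:~R) ltr_int.
by rewrite -subrX1 xM subrr.
Qed.

(** * The discretized Fejer kernel *)

(** This is [N] times the Fejer kernel, that is the squared modulus of [1 + z + ... + z^(N-1)] at
    [z = expi u]. The expanded double sum displays its frequencies, all smaller than [N] in absolute
    value. *)
Definition dirichlet_sq (R : realType) (N : nat) (u : R) : R :=
  \sum_(k < N) \sum_(l < N) cos ((k%:Z - l%:Z)%:~R * u).

Lemma dirichlet_sqE (R : realType) (N : nat) (u : R) :
  dirichlet_sq N u = sqnormc (\sum_(k < N) expi u ^+ k).
Proof.
rewrite sqnormcE conjc_sum big_distrlr /= Re_sum; apply: eq_bigr => k _.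
rewrite Re_sum; apply: eq_bigr => l _.
by rewrite -!expi_mulrn -expiN -expiD rmorphB /= mulrBl.
Qed.

Lemma dirichlet_sq_ge0 (R : realType) (N : nat) (u : R) : 0 <= dirichlet_sq N u.
Proof. by rewrite dirichlet_sqE sqnormc_ge0. Qed.

Lemma sqnormc_expiB1 (R : realType) (u : R) :
  sqnormc (expi u - 1) = 2 * (1 - cos u).
Proof. by rewrite /sqnormc !ReImE /=; have := cos2Dsin2 u; lra. Qed.

(** Squared modulus of the geometric identity [(z - 1) (1 + ... + z^(N-1)) = z^N - 1], both outer
    factors being squared chords. *)
Lemma dirichlet_sq_1cos (R : realType) (N : nat) (u : R) :
  dirichlet_sq N u * (1 - cos u) = 1 - cos (N%:R * u).
Proof.
suff : 2 * (dirichlet_sq N u * (1 - cos u)) = 2 * (1 - cos (N%:R * u)) by lra.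
rewrite mulrCA -!sqnormc_expiB1 dirichlet_sqE -sqnormcM expi_mulrn subrX1.
by rewrite mulrC.
Qed.

(** Off the diagonal [k = l] the frequency is nonzero and below [N.+1], so the sum over the nodes
    kills it; each of the [N] diagonal terms contributes [N.+1]. *)
Lemma sum_dirichlet_sq (R : realType) (N : nat) (t : R) :
  \sum_(j < N.+1) dirichlet_sq N (t - (pi *+ 2) * j%:R / N.+1%:R)
    = N%:R * N.+1%:R.
Proof.
rewrite /dirichlet_sq exchange_big /=.
transitivity (\sum_(k < N) (N.+1%:R : R)); last first.
  by rewrite sumr_const card_ord mulr_natl.
apply: eq_bigr => k _; rewrite exchange_big /= (bigD1 k)//= [X in _ + X]big1 ?addr0.
  under eq_bigr do rewrite subrr mul0r cos0.
  by rewrite sumr_const card_ord.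
move=> l lk.
have := @sum_expi_eq0 R N.+1 (k%:Z - l%:Z) t.
move=> /(_ _ _)/(congr1 (@complex.Re R)); rewrite Re_sum; apply.
  by rewrite subr_eq0; apply: contra lk => /eqP[kl]; apply/eqP/val_inj.
by move: (ltn_ord k) (ltn_ord l); lia.
Qed.

(** The closed form leaves the single frequency [N]. This is why there are [N.+1] nodes: over [N]
    nodes this frequency would alias to a constant and not cancel. *)
Lemma sum_dirichlet_sq_1cos (R : realType) (N : nat) (t : R) : (0 < N)%N ->
  \sum_(j < N.+1) dirichlet_sq N (t - (pi *+ 2) * j%:R / N.+1%:R) *
     (1 - cos (t - (pi *+ 2) * j%:R / N.+1%:R)) = N.+1%:R.
Proof.
move=> N0; under eq_bigr do rewrite dirichlet_sq_1cos.
rewrite sumrB sumr_const card_ord.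
have := @sum_expi_eq0 R N.+1 N%:Z t.
move=> /(_ _ _)/(congr1 (@complex.Re R)); rewrite Re_sum /= => ->.
    by rewrite subr0.
  by rewrite -lt0n.
by rewrite ltz_nat ltnS.
Qed.

(** On the square, [1 - cos (s - t)] vanishes only on the diagonal and at the two corners joining 0
    to [2 pi], where [g s = g t] as well. Near such points continuity suffices; elsewhere [1 - cos]
    is bounded below and a large [C] wins. Compactness makes [C] uniform. *)
Lemma periodic_modulus (R : realType) (g : R -> R) (e : R) :
  continuous g -> g (pi *+ 2) = g 0 -> 0 < e ->
  exists C : R, 0 <= C /\ forall s t,
    s \in `[0, pi *+ 2] -> t \in `[0, pi *+ 2] ->
    `|g s - g t| <= e + C * (1 - cos (s - t)).
Proof.
move=> gc gper e0.
pose I : set R := `[0, pi *+ 2]%classic.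
have gB (p : R * R) : g x.1 - g x.2 @[x --> p] --> g p.1 - g p.2.
  apply: cvgB; apply: (@cvg_comp _ _ _ _ g _ (nbhs _)); try exact: gc.
  - exact: cvg_fst.
  - exact: cvg_snd.
have cB (p : R * R) : 1 - cos (x.1 - x.2) @[x --> p] --> 1 - cos (p.1 - p.2).
  apply: cvgB; first exact: cvg_cst.
  apply: (@cvg_comp _ _ _ _ cos _ (nbhs _)); last exact: continuous_cos.
  by apply: cvgB; [exact: cvg_fst|exact: cvg_snd].
have cmp : compact (I `*` I) by apply: compact_setX; exact: segment_compact.
have cos1 (u : R) : 0 <= 1 - cos u by rewrite subr_ge0 cos_le1.
have : \forall C \near +oo, I `*` I `<=` (fun p : R * R =>
    `|g p.1 - g p.2| <= e + C * (1 - cos (p.1 - p.2))).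
  move/compact_near_coveringP : cmp; apply => -[s t] [/= Is It].
  have [st1|st1] := eqVneq (cos (s - t)) 1.
    have gst : g s = g t.
      wlog ts : s t Is It st1 {gB cB} / t <= s.
        move=> wlg; have [ts|/ltW st] := leP t s; first exact: wlg.
        by apply/esym/wlg => //; rewrite -opprB cosN.
      move: Is It; rewrite /I /= !in_itv /= => /andP[s0 s2] /andP[t0 t2].
      have [st|st] := leP (s - t) pi.
        suff : s - t = 0 by move/eqP; rewrite subr_eq0 => /eqP ->.
        apply: (@cos_inj R); rewrite ?in_itv/= ?cos0 ?lexx ?pi_ge0//.
        by rewrite subr_ge0 ts.
      suff : pi *+ 2 - (s - t) = 0.
        move=> H; have [-> ->] : s = pi *+ 2 /\ t = 0 by split; lra.
        exact: gper.
      have pi0 := pi_ge0 R.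
      apply: (@cos_inj R); rewrite ?in_itv/= ?cos0 ?lexx ?pi_ge0//.
        by apply/andP; split; rewrite mulr2n in s2 t2 *; lra.
      by rewrite addrC cosD2pi cosN.
    have := cvgr_norm_lt _ (gB (s, t)) e; rewrite /= gst subrr normr0 => /(_ _ e0) H.
    near=> x C => /=.
    have C0 : 0 <= C by near: C; exact: nbhs_pinfty_ge.
    apply: ltW; apply: (@lt_le_trans _ _ e); first by near: x.
    by rewrite lerDl mulr_ge0.
  have [c cE] : {c | c = 1 - cos (s - t)} by exists (1 - cos (s - t)).
  have c0 : 0 < c by rewrite cE lt_neqAle cos1 andbT eq_sym subr_eq0 eq_sym.
  have c2 : c / 2 < c by lra.
  rewrite cE in c2 c0 *; have H1 := cvgr_gt _ (cB (s, t)) _ c2.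
  have g2 : `|g s - g t| < `|g s - g t| + 1 by rewrite ltrDl.
  have H2 := cvgr_norm_lt _ (gB (s, t)) _ g2.
  near=> x C => /=.
  (* Near [(s, t)] the left side stays below [|g s - g t| + 1] and [1 - cos] above half of its value
     there, so [C] has to exceed the quotient. *)
  have C0 : (`|g s - g t| + 1) / ((1 - cos (s - t)) / 2) <= C.
    by near: C; apply: nbhs_pinfty_ge; exact: num_real.
  apply: (@le_trans _ _ (`|g s - g t| + 1)); first by apply: ltW; near: x; exact: H2.
  apply: (@le_trans _ _ (C * ((1 - cos (s - t)) / 2))).
    by rewrite -ler_pdivrMr// divr_gt0.
  have C00 : 0 <= C.
    by apply: le_trans C0; rewrite divr_ge0 ?addr_ge0// divr_ge0.
  apply: ler_wpDl; first exact: ltW.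
  by apply: ler_wpM2l => //; apply: ltW; near: x; exact: H1.
move=> H.
have [C [C0 HC]] : exists C : R, 0 <= C /\ I `*` I `<=` (fun p : R * R =>
    `|g p.1 - g p.2| <= e + C * (1 - cos (p.1 - p.2))).
  near (@pinfty_nbhs R) => C; exists C; split; last by near: C.
  by near: C; exact: nbhs_pinfty_ge.
by exists C; split => // s t Is It; apply: (HC (s, t)).
Unshelve. all: by end_near.
Qed.

(** * Trigonometric polynomials and uniform approximation *)

(** The closure rule has the shape [f + c * g] in which [unitary_L2] states linearity, so an
    identity linear in [p] is proved by direct induction. *)
Inductive trigpoly (R : realType) : (R -> R[i]) -> Prop :=
| trigpoly_expi (k : int) : trigpoly (fun t => expi (k%:~R * t))
| trigpoly_lin f g (c : R[i]) : trigpoly f -> trigpoly g ->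
    trigpoly (fun t => f t + c * g t).

Lemma trigpoly_ext (R : realType) (f g : R -> R[i]) :
  f =1 g -> trigpoly f -> trigpoly g.
Proof. by move=> /funext ->. Qed.

Lemma trigpoly0 (R : realType) : trigpoly (fun _ : R => 0).
Proof.
apply: (@trigpoly_ext _ (fun t => expi (0%:~R * t) + (-1) * expi (0%:~R * t))).
  by move=> t; rewrite mulN1r subrr.
by apply: trigpoly_lin; exact: trigpoly_expi.
Qed.

Lemma trigpolyZ (R : realType) (c : R[i]) (f : R -> R[i]) :
  trigpoly f -> trigpoly (fun t => c * f t).
Proof.
move=> tf; apply: (@trigpoly_ext _ (fun t => 0 + c * f t)).
  by move=> t; rewrite add0r.
exact/trigpoly_lin/tf/trigpoly0.
Qed.

Lemma trigpolyD (R : realType) (f g : R -> R[i]) :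
  trigpoly f -> trigpoly g -> trigpoly (fun t => f t + g t).
Proof.
move=> tf tg; apply: (@trigpoly_ext _ (fun t => f t + 1 * g t)).
  by move=> t; rewrite mul1r.
exact: trigpoly_lin.
Qed.

Lemma trigpoly_cst (R : realType) (c : R[i]) : trigpoly (fun _ : R => c).
Proof.
apply: (@trigpoly_ext _ (fun t => c * expi (0%:~R * t))).
  by move=> t; rewrite mul0r expi0 mulr1.
exact/trigpolyZ/trigpoly_expi.
Qed.

Lemma trigpoly_sum (R : realType) n (F : 'I_n -> R -> R[i]) :
  (forall i, trigpoly (F i)) -> trigpoly (fun t => \sum_i F i t).
Proof.
elim: n F => [|n IH] F tF.
  by apply: trigpoly_ext (trigpoly0 R) => t; rewrite big_ord0.
apply: (@trigpoly_ext _ (fun t =>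
  \sum_i F (widen_ord (leqnSn n) i) t + F ord_max t)).
  by move=> t; rewrite big_ord_recr.
by apply: trigpolyD => //; exact: IH.
Qed.

Lemma trigpoly_periodic (R : realType) (p : R -> R[i]) :
  trigpoly p -> forall t, p (t + pi *+ 2) = p t.
Proof.
elim=> [k t|f g c _ IHf _ IHg t]; last by rewrite IHf IHg.
by rewrite mulrDr expiD expi_2pi_int mulr1.
Qed.

Lemma trigpoly_cos (R : realType) (k : int) (a : R) :
  trigpoly (fun t => (cos (k%:~R * (t - a)))%:C%C).
Proof.
pose c : R[i] := expi (- (k%:~R * a)).
apply: (@trigpoly_ext _ (fun t => (2^-1 * c) * expi (k%:~R * t) +
   (2^-1 * conjc c) * expi ((- k)%:~R * t))).
  move=> t; pose X : R := k%:~R * (t - a).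
  have E : expi X = c * expi (k%:~R * t).
    by rewrite -expiD; congr expi; rewrite /X; ring.
  have E' : conjc (expi X) = conjc c * expi ((- k)%:~R * t).
    by rewrite -!expiN -expiD rmorphN; congr expi; rewrite /X; ring.
  have -> : (cos X)%:C%C = (expi X + conjc (expi X)) / 2 := ReJ_add (expi X).
  by rewrite E' E; ring.
by apply: trigpolyD; exact/trigpolyZ/trigpoly_expi.
Qed.

Lemma trigpoly_dirichlet_sq (R : realType) N (a : R) :
  trigpoly (fun t => (dirichlet_sq N (t - a))%:C%C).
Proof.
apply: (@trigpoly_ext _ (fun t => \sum_(k < N) \sum_(l < N)
   (cos ((k%:Z - l%:Z)%:~R * (t - a)))%:C%C)).
  by move=> t; rewrite rmorph_sum; apply: eq_bigr => k _; rewrite rmorph_sum.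
by do 2 apply: trigpoly_sum => ?; exact: trigpoly_cos.
Qed.

(* Korovkin's argument: the weights
   [w j = dirichlet_sq N (t - x j) / (N (N + 1))] are nonnegative, have
   total mass 1 and satisfy [\sum_j w j (1 - cos (t - x j)) = 1 / N]. *)
Lemma fejer_approx (R : realType) (g : R -> R) (e : R) :
  continuous g -> g (pi *+ 2) = g 0 -> 0 < e ->
  exists p : R -> R[i], trigpoly p /\ forall t, t \in `[0, pi *+ 2] ->
    `|complex.Re (p t) - g t| <= e /\ complex.Im (p t) = 0.
Proof.
move=> gc gper e0; have e20 : 0 < e / 2 by rewrite divr_gt0.
have [C [C0 HC]] := periodic_modulus gc gper e20.
have pi0 : 0 < (pi *+ 2 : R) by rewrite pmulrn_lgt0// pi_gt0.
(* The error will be [e / 2 + C / N]; the successor also makes [N] positive. *)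
pose N := (Num.bound (C / (e / 2))).+1.
have NR0 : 0 < (N%:R : R) by rewrite ltr0n.
have NC : C / N%:R <= e / 2.
  rewrite ler_pdivrMr// mulrC -ler_pdivrMr// ltW//.
  apply: (lt_le_trans (archi_boundP _)); first by rewrite divr_ge0// ltW.
  by rewrite ler_nat.
pose x (j : nat) : R := (pi *+ 2) * j%:R / N.+1%:R.
have N10 : 0 < (N.+1%:R : R) by rewrite ltr0n.
have xI (j : 'I_N.+1) : x j \in `[0, pi *+ 2].
  rewrite in_itv/= /x divr_ge0 ?mulr_ge0 ?(ltW pi0)//=.
  by rewrite ler_pdivrMr// ler_pM2l// ler_nat ltnW.
have NN0 : N%:R * N.+1%:R != 0 :> R by rewrite mulf_neq0 ?gt_eqF.
pose w (j : nat) t : R := dirichlet_sq N (t - x j) / (N%:R * N.+1%:R).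
have w0 j t : 0 <= w j t by rewrite divr_ge0 ?dirichlet_sq_ge0// mulr_ge0// ltW.
have w1 t : \sum_(j < N.+1) w j t = 1.
  by rewrite -mulr_suml sum_dirichlet_sq divff.
have w2 t : \sum_(j < N.+1) w j t * (1 - cos (t - x j)) = N%:R^-1.
  under eq_bigr do rewrite mulrAC.
  have M0 : N.+1%:R != 0 :> R by rewrite gt_eqF.
  by rewrite -mulr_suml sum_dirichlet_sq_1cos// invfM mulrCA (divff M0) mulr1.
exists (fun t => \sum_(j < N.+1) (g (x j) * w j t)%:C%C); split.
  apply: trigpoly_sum => j.
  apply: (@trigpoly_ext _ (fun t => (g (x j) / (N%:R * N.+1%:R))%:C%C *
     (dirichlet_sq N (t - x j))%:C%C)).
    by move=> t; rewrite -rmorphM; congr (_%:C)%C; rewrite /w; ring.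
  exact/trigpolyZ/trigpoly_dirichlet_sq.
move=> t tI; rewrite -rmorph_sum /=; split => //.
have -> : g t = \sum_(j < N.+1) g t * w j t by rewrite -mulr_sumr w1 mulr1.
rewrite -sumrB; apply: (le_trans (ler_norm_sum _ _ _)).
apply: (@le_trans _ _ (\sum_(j < N.+1)
    (e / 2 * w j t + C * (w j t * (1 - cos (t - x j)))))).
  apply: ler_sum => j _; rewrite -mulrBl normrM (ger0_norm (w0 _ _)).
  have := HC _ _ (xI j) tI; rewrite -[x j - t]opprB cosN => /(ler_wpM2r (w0 j t)).
  by move=> /le_trans; apply; rewrite le_eqVlt; apply/orP; left; apply/eqP; ring.
rewrite big_split/= -!mulr_sumr w1 w2; lra.
Qed.

(** The approximants of the two components are real-valued on the period, so they recombine as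
    [p + i q] without mixing the errors. *)
Lemma fejer_approxC (R : realType) (g : R -> R[i]) (e : R) :
  continuous (fun t => complex.Re (g t) : R) ->
  continuous (fun t => complex.Im (g t) : R) ->
  g (pi *+ 2) = g 0 -> 0 < e ->
  exists p : R -> R[i], trigpoly p /\ forall t, t \in `[0, pi *+ 2] ->
    `|complex.Re (g t - p t)| <= e /\ `|complex.Im (g t - p t)| <= e.
Proof.
move=> cR cI gper e0.
have [|p [tp Hp]] := fejer_approx cR _ e0; first by rewrite gper.
have [|q [tq Hq]] := fejer_approx cI _ e0; first by rewrite gper.
exists (fun t => p t + 'i%C * q t); split; first exact: trigpoly_lin.
move=> t tI; have [p1 p2] := Hp _ tI; have [q1 q2] := Hq _ tI.
rewrite !ReImE /= p2 q2; split.
  by rewrite distrC; apply: le_trans p1; rewrite le_eqVlt; apply/orP; left;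
    apply/eqP; congr `|_|; ring.
by rewrite distrC; apply: le_trans q1; rewrite le_eqVlt; apply/orP; left;
    apply/eqP; congr `|_|; ring.
Qed.

(** * Derivatives on the circle *)

Lemma is_derive_mul (R : realType) (u v : R -> R) (t du dv d : R) :
  is_derive t 1 u du -> is_derive t 1 v dv -> d = du * v t + u t * dv ->
  is_derive t 1 (fun s => u s * v s) d.
Proof.
move=> hu hv ->; have H := is_deriveM hu hv.
apply: (@is_derive_eq _ _ _ _ _ _ _ _ H).
by rewrite /GRing.scale /= addrC mulrC.
Qed.

Lemma is_derive_add (R : realType) (u v : R -> R) (t du dv d : R) :
  is_derive t 1 u du -> is_derive t 1 v dv -> d = du + dv ->
  is_derive t 1 (fun s => u s + v s) d.
Proof. by move=> hu hv ->; exact: is_deriveD. Qed.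

Lemma is_derive_sub (R : realType) (u v : R -> R) (t du dv d : R) :
  is_derive t 1 u du -> is_derive t 1 v dv -> d = du - dv ->
  is_derive t 1 (fun s => u s - v s) d.
Proof. by move=> hu hv ->; exact: is_deriveB. Qed.

Lemma is_derive_mull (R : realType) (u : R -> R) (k t du d : R) :
  is_derive t 1 u du -> d = k * du ->
  is_derive t 1 (fun s => k * u s) d.
Proof. by move=> hu ->; exact: is_deriveZ. Qed.

Lemma is_derive_ext (R : realType) (u v : R -> R) (t d : R) :
  u =1 v -> is_derive t 1 u d -> is_derive t 1 v d.
Proof. by move=> /funext ->. Qed.

(** Carrying the derivative as an explicit function lets the sum and product rules compose without
    separate differentiability conditions; [cderive_dangle] converts back to [dangle]. *)
Definition cderive (R : realType) (f f' : R -> R[i]) : Prop :=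
  forall t : R, is_derive t (1 : R) (fun s => complex.Re (f s)) (complex.Re (f' t)) /\
    is_derive t (1 : R) (fun s => complex.Im (f s)) (complex.Im (f' t)).

Lemma cderive_ext (R : realType) (f f' g g' : R -> R[i]) :
  f =1 g -> f' =1 g' -> cderive f f' -> cderive g g'.
Proof. by move=> /funext -> /funext ->. Qed.

Lemma cderiveM (R : realType) (f f' g g' : R -> R[i]) :
  cderive f f' -> cderive g g' ->
  cderive (fun t => f t * g t) (fun t => f' t * g t + f t * g' t).
Proof.
move=> df dg t; have [[f1 f2] [g1 g2]] := (df t, dg t); split.
  apply: is_derive_ext (fun s => esym (ReM (f s) (g s))) _.
  apply: is_derive_sub (is_derive_mul f1 g1 erefl) (is_derive_mul f2 g2 erefl) _.
  by rewrite !ReImE; ring.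
apply: is_derive_ext (fun s => esym (ImM (f s) (g s))) _.
apply: is_derive_add (is_derive_mul f1 g2 erefl) (is_derive_mul f2 g1 erefl) _.
by rewrite !ReImE; ring.
Qed.

Lemma cderiveD (R : realType) (f f' g g' : R -> R[i]) :
  cderive f f' -> cderive g g' ->
  cderive (fun t => f t + g t) (fun t => f' t + g' t).
Proof.
move=> df dg t; have [[f1 f2] [g1 g2]] := (df t, dg t); split.
  apply: is_derive_ext (fun s => esym (ReD (f s) (g s))) _.
  by apply: is_derive_add f1 g1 _; rewrite ReD.
apply: is_derive_ext (fun s => esym (ImD (f s) (g s))) _.
by apply: is_derive_add f2 g2 _; rewrite ImD.
Qed.

Lemma cderive_cst (R : realType) (c : R[i]) :
  cderive (fun _ : R => c) (fun _ => 0).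
Proof. by move=> t; split; exact: is_derive_cst. Qed.

Lemma cderiveZ (R : realType) (f f' : R -> R[i]) (c : R[i]) :
  cderive f f' -> cderive (fun t => c * f t) (fun t => c * f' t).
Proof.
move=> df; apply: cderive_ext (cderiveM (@cderive_cst R c) df) => // t.
by rewrite mul0r add0r.
Qed.

Lemma cderive_lin (R : realType) (f f' g g' : R -> R[i]) (c : R[i]) :
  cderive f f' -> cderive g g' ->
  cderive (fun t => f t + c * g t) (fun t => f' t + c * g' t).
Proof. by move=> df dg; exact/cderiveD/cderiveZ. Qed.

Lemma cderive_expi (R : realType) (k : R) :
  cderive (fun t => expi (k * t)) (fun t => 'i%C * k%:C%C * expi (k * t)).
Proof.
move=> t.
have kt : is_derive t 1 (fun s : R => k * s) k.
  by apply: (is_derive_mull (is_derive_id _ _)); rewrite mulr1.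
split.
  have H : is_derive t 1 (fun s => complex.Re (expi (k * s))) (- sin (k * t) * k) :=
    is_derive1_comp (is_derive_cos (k * t)) kt.
  by apply: (is_derive_eq H); rewrite !ReImE /=; ring.
have H : is_derive t 1 (fun s => complex.Im (expi (k * s))) (cos (k * t) * k) :=
  is_derive1_comp (is_derive_sin (k * t)) kt.
by apply: (is_derive_eq H); rewrite !ReImE /=; ring.
Qed.

Lemma cderive_expi1 (R : realType) :
  cderive (@expi R) (fun t => 'i%C * expi t).
Proof.
apply: cderive_ext (cderive_expi 1) => t; first by rewrite mul1r.
by rewrite mulr1 mul1r.
Qed.

Lemma cderive_continuous (R : realType) (f f' : R -> R[i]) : cderive f f' ->
  continuous (fun t => complex.Re (f t) : R) /\
  continuous (fun t => complex.Im (f t) : R).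
Proof.
move=> df; split=> t; have [? ?] := df t;
  by apply/differentiable_continuous/derivable1_diffP; exact: ex_derive.
Qed.

Lemma trigpoly_cderive (R : realType) (p : R -> R[i]) : trigpoly p ->
  exists2 p', trigpoly p' & cderive p p'.
Proof.
elim=> [k|f g c _ [f' tf df] _ [g' tg dg]].
  exists (fun t => 'i%C * (k%:~R : R)%:C%C * expi (k%:~R * t)).
    exact/trigpolyZ/trigpoly_expi.
  exact: cderive_expi.
exists (fun t => f' t + c * g' t); first exact: trigpoly_lin.
exact: cderive_lin.
Qed.

(** The zero frequency is the only one without a periodic primitive; [c] collects its
    coefficient. *)
Lemma trigpoly_primitive (R : realType) (p : R -> R[i]) : trigpoly p ->
  exists c P, trigpoly P /\ cderive P (fun t => p t - c).
Proof.
elim=> [k|f g c _ [a [F [tF dF]]] _ [b [G [tG dG]]]].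
  have [->|k0] := eqVneq k 0.
    exists 1, (fun _ => 0); split; first exact: trigpoly0.
    apply: cderive_ext (cderive_cst 0) => // t.
    by rewrite mul0r expi0 subrr.
  pose d : R[i] := 'i%C * (k%:~R : R)%:C%C.
  have d0 : d != 0.
    rewrite mulf_neq0//; first by rewrite eq_complex /= oner_eq0 andbF.
    by rewrite eq_complex /= intr_eq0 (negbTE k0).
  exists 0, (fun t => d^-1 * expi (k%:~R * t)); split.
    exact/trigpolyZ/trigpoly_expi.
  apply: cderive_ext (cderiveZ d^-1 (cderive_expi _)) => // t.
  by rewrite subr0 mulrA mulVf// mul1r.
exists (a + c * b), (fun t => F t + c * G t); split; first exact: trigpoly_lin.
by apply: cderive_ext (cderive_lin c dF dG) => // t; ring.
Qed.

Lemma cderive_dangle (R : realType) (f f' : R -> R[i]) :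
  cderive f f' -> dangle f = f'.
Proof.
move=> df; apply/funext => t; have [? ?] := df t.
by apply: complex_ext; rewrite /dangle /= derive1E derive_val.
Qed.

Lemma C1_circle_cderive (R : realType) (f : R -> R[i]) :
  C1_circle f -> cderive f (dangle f).
Proof.
move=> [_ [f1 [f2 _]]] t; rewrite /dangle /= !derive1E.
by split; exact: derivableP.
Qed.

Lemma cderive_C1_circle (R : realType) (f f' : R -> R[i]) :
  (forall t, f (t + pi *+ 2) = f t) -> cderive f f' ->
  continuous (fun t => complex.Re (f' t) : R) ->
  continuous (fun t => complex.Im (f' t) : R) -> C1_circle f.
Proof.
move=> fper df c1 c2; have dfE := cderive_dangle df; split => //.
split; first by move=> t; have [? _] := df t; exact: ex_derive.
split; first by move=> t; have [_ ?] := df t; exact: ex_derive.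
have E1 : derive1 (fun s => complex.Re (f s)) = (fun t => complex.Re (f' t)).
  by rewrite -dfE.
have E2 : derive1 (fun s => complex.Im (f s)) = (fun t => complex.Im (f' t)).
  by rewrite -dfE.
by split; [rewrite E1|rewrite E2].
Qed.

Lemma C1_circle_lin (R : realType) (f g : R -> R[i]) (c : R[i]) :
  C1_circle f -> C1_circle g -> C1_circle (fun t => f t + c * g t).
Proof.
move=> Cf Cg; have [[fper [_ [_ [f1 f2]]]] [gper [_ [_ [g1 g2]]]]] := (Cf, Cg).
apply: (@cderive_C1_circle _ _ (fun t => dangle f t + c * dangle g t)).
- by move=> t; rewrite fper gper.
- by apply: cderive_lin; exact: C1_circle_cderive.
- move=> t; under eq_fun do rewrite !ReImE.
  by apply: cvgD; [exact: f1|apply: cvgB; apply: cvgM; (try exact: cvg_cst);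
    [exact: g1|exact: g2]].
- move=> t; under eq_fun do rewrite !ReImE.
  by apply: cvgD; [exact: f2|apply: cvgD; apply: cvgM; (try exact: cvg_cst);
    [exact: g2|exact: g1]].
Qed.

Lemma C1_circle_trigpoly (R : realType) (p : R -> R[i]) :
  trigpoly p -> C1_circle p.
Proof.
move=> tp; have [p' tp' dp] := trigpoly_cderive tp.
have [p'' _ dp'] := trigpoly_cderive tp'.
have [c1 c2] := cderive_continuous dp'.
exact: cderive_C1_circle (trigpoly_periodic tp) dp c1 c2.
Qed.

(** * Mean value estimates and approximation in the C^1 norm *)

Lemma mean_value_le (R : realType) (u u' : R -> R) (a b e : R) : a <= b ->
  (forall x : R, is_derive x (1 : R) u (u' x)) ->
  (forall x, x \in `[a, b] -> `|u' x| <= e) -> `|u b - u a| <= e * (b - a).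
Proof.
move=> ab du ue; have [|c cab ->] := @MVT_segment _ u u' a b ab (fun x _ => du x).
  apply: continuous_subspaceT => x.
  by apply/differentiable_continuous/derivable1_diffP; have ? := du x; exact: ex_derive.
by rewrite normrM (ger0_norm (_ : 0 <= b - a)) ?subr_ge0// ler_wpM2r ?subr_ge0// ue.
Qed.

(** The chain rule for the shift by [2 pi] passes periodicity to the derivative; this is the
    endpoint condition under which the approximation applies to [f']. *)
Lemma dangle_2pi (R : realType) (f : R -> R[i]) :
  C1_circle f -> dangle f (pi *+ 2) = dangle f 0.
Proof.
have shift (u : R -> R) : (forall t, u (t + pi *+ 2) = u t) ->
    (forall t : R, derivable u t 1) -> derive1 u (pi *+ 2) = derive1 u 0.
  move=> uper du; rewrite -[in RHS](_ : u \o (fun s => s + pi *+ 2) = u); last first.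
    by apply/funext => s /=; exact: uper.
  rewrite !derive1E; apply/esym; apply: derive_val.
  rewrite -[X in is_derive _ _ _ X]mulr1; apply: is_derive1_comp.
    by rewrite add0r; exact: derivableP.
  by apply: is_derive_add (is_derive_id _ _) (is_derive_cst _ _ _) _; rewrite addr0.
move=> [fper [d1 [d2 _]]].
by rewrite /dangle !shift// => t; rewrite fper.
Qed.

(** Half of [e] pays for approximating [f'], the other half for discarding the mean [c], without
    which the primitive would not be periodic. The normalization at 0 lets the bound on the
    derivatives integrate to a bound on [f - p]. *)
Lemma C1_circle_approx (R : realType) (f : R -> R[i]) (e : R) :
  C1_circle f -> 0 < e ->
  exists p : R -> R[i], [/\ trigpoly p, p 0 = f 0 &
    forall t, t \in `[0, pi *+ 2] ->
    `|complex.Re (dangle f t - dangle p t)| <= e /\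
    `|complex.Im (dangle f t - dangle p t)| <= e].
Proof.
move=> Cf e0; have e20 : 0 < e / 2 by rewrite divr_gt0.
have df := C1_circle_cderive Cf.
have [fper [_ [_ [f1 f2]]]] := Cf.
have f'per := dangle_2pi Cf.
have [p [tp Hp]] := @fejer_approxC _ (dangle f) _ f1 f2 f'per e20.
have [c [P [tP dP]]] := trigpoly_primitive tp.
have dPE := cderive_dangle dP.
have pi0 : 0 < (pi *+ 2 : R) by rewrite pmulrn_lgt0// pi_gt0.
(* The constant term c is small: f - P - c t has derivative f' - p, bounded by
   e / 2, and increment - 2 pi c over a period. *)
have I0 : 0 \in `[0, pi *+ 2 :> R] by rewrite in_itv/= lexx ltW.
have P0 : P (pi *+ 2) = P 0 by rewrite -[pi *+ 2]add0r trigpoly_periodic.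
have f0 : f (pi *+ 2) = f 0 by rewrite -[pi *+ 2]add0r fper.
have small (u v : R -> R) (w w' : R -> R) (d : R) :
    (forall t : R, is_derive t (1 : R) u (w t)) ->
    (forall t : R, is_derive t (1 : R) v (w' t - d)) ->
    u (pi *+ 2) = u 0 -> v (pi *+ 2) = v 0 ->
    (forall t, t \in `[0, pi *+ 2] -> `|w t - w' t| <= e / 2) -> `|d| <= e / 2.
  move=> du dv u0 v0 uv.
  have : `|(u (pi *+ 2) - v (pi *+ 2) - d * (pi *+ 2)) - (u 0 - v 0 - d * 0)| <=
      e / 2 * (pi *+ 2 - 0).
    apply: (@mean_value_le _ (fun t => u t - v t - d * t) (fun t => w t - w' t)).
    - exact: ltW.
    - move=> t; apply: is_derive_sub (is_derive_sub (du t) (dv t) erefl)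
        (is_derive_mull (is_derive_id _ _) erefl) _; ring.
    - exact: uv.
  rewrite u0 v0 subr0 mulr0 subr0 addrAC subrr add0r normrN normrM.
  by rewrite (gtr0_norm pi0) ler_pM2r.
have [c1 c2] : `|complex.Re c| <= e / 2 /\ `|complex.Im c| <= e / 2.
  split.
    apply: (small (fun t => complex.Re (f t)) (fun t => complex.Re (P t))
      (fun t => complex.Re (dangle f t)) (fun t => complex.Re (p t))).
    - by move=> t; have [] := df t.
    - by move=> t; have [+ _] := dP t; rewrite !ReImE.
    - by rewrite f0.
    - by rewrite P0.
    - by move=> t /Hp[+ _]; rewrite !ReImE.
  apply: (small (fun t => complex.Im (f t)) (fun t => complex.Im (P t))
      (fun t => complex.Im (dangle f t)) (fun t => complex.Im (p t))).
  - by move=> t; have [] := df t.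
  - by move=> t; have [_ +] := dP t; rewrite !ReImE.
  - by rewrite f0.
  - by rewrite P0.
  - by move=> t /Hp[_ +]; rewrite !ReImE.
have dP' : cderive (fun t => P t + (f 0 - P 0)) (fun t => p t - c).
  apply: cderive_ext (cderiveD dP (cderive_cst (f 0 - P 0))) => // t.
  by rewrite addr0.
exists (fun t => P t + (f 0 - P 0)); split.
- exact/trigpolyD/trigpoly_cst.
- by rewrite addrC subrK.
- move=> t tI; rewrite (cderive_dangle dP').
  have [h1 h2] := Hp _ tI; rewrite opprB addrA addrAC [complex.Re (_ + _)]ReD.
  rewrite [complex.Im (_ + _)]ImD; split; apply: (le_trans (ler_normD _ _)); lra.
Qed.

(** * Bounds on the difference kernel *)

(** With [x = u / 4] and [u >= 0], [1 - cos u = 2 sin(2x)^2], while [sin(2x) = 2 sin x cos x >= 2 x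
    cos(x)^2 >= x] because [cos(2x) >= 0]. Hence [u^2 / 16 <= (1 - cos u) / 2]. The constant 8 is
    not sharp. *)
Lemma cos_chord (R : realType) (u : R) : `|u| <= pi -> u ^+ 2 <= 8 * (1 - cos u).
Proof.
have pi0 := pi_gt0 R.
have sin_ge (y : R) : 0 <= y -> y <= pi -> y * cos y <= sin y.
  move=> y0 ypi; have [|c cI] :=
    @MVT_segment _ sin cos 0 y y0 (fun x _ => is_derive_sin x).
    by apply: continuous_subspaceT => x; exact: continuous_sin.
  rewrite sin0 !subr0 => ->; rewrite mulrC ler_wpM2r//.
  move: cI; rewrite in_itv/= => /andP[c0 cy].
  rewrite leNgt ltr_cos ?in_itv/= ?c0 ?y0 ?ypi ?(le_trans cy)//.
  by rewrite -leNgt.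
have main (v : R) : 0 <= v -> v <= pi -> v ^+ 2 <= 8 * (1 - cos v).
  move=> v0 vpi; set x := v / 4.
  have cx : 0 <= cos x by apply: cos_ge0_pihalf; rewrite /x; lra.
  have c2 : 0 <= cos (x + x) by apply: cos_ge0_pihalf; rewrite /x; lra.
  have hx := sin_ge x ltac:(by rewrite /x; lra) ltac:(by rewrite /x; lra).
  have E2 : cos (x + x) = 2 * cos x ^+ 2 - 1.
    by rewrite cosD; have := cos2Dsin2 x; lra.
  have E4 : cos v = 1 - 2 * sin (x + x) ^+ 2.
    have -> : v = (x + x) + (x + x) by rewrite /x; lra.
    by rewrite cosD; have := cos2Dsin2 (x + x); lra.
  have x0 : 0 <= x by rewrite /x; lra.
  have s2 : x <= sin (x + x).
    rewrite sinD.
    have : x * cos x * cos x <= sin x * cos x by apply: ler_wpM2r.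
    have c1 : 1 <= 2 * cos x ^+ 2 by rewrite -subr_ge0 -E2.
    have : x * 1 <= x * (2 * cos x ^+ 2) by apply: ler_wpM2l.
    lra.
  have : x ^+ 2 <= sin (x + x) ^+ 2 by rewrite ler_sqr ?nnegrE ?(le_trans x0 s2).
  rewrite E4 /x; lra.
move=> upi; rewrite -real_normK ?num_real//.
have -> : cos u = cos `|u| by case: (ler0P u) => // _; rewrite cosN.
exact: main.
Qed.

Lemma sqnormc_expiB (R : realType) (s t : R) :
  sqnormc (expi s - expi t) = 2 * (1 - cos (s - t)).
Proof.
rewrite -sqnormc_expiB1 -[LHS]mulr1 -[X in _ * X](sqnormc_expi (- t)) -sqnormcM.
by rewrite mulrBl -!expiD subrr expi0.
Qed.

(** The mean value inequality is applied along the shorter arc, whose length [d <= pi] is admissible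
    in [cos_chord]. When [s - t > pi] that arc passes through the point 0 = [2 pi], and the two
    pieces are glued by [u (pi *+ 2) = u 0]. *)
Lemma periodic_lipschitz (R : realType) (u u' : R -> R) (e s t : R) :
  u (pi *+ 2) = u 0 ->
  (forall x : R, is_derive x (1 : R) u (u' x)) ->
  (forall x, x \in `[0, pi *+ 2] -> `|u' x| <= e) ->
  s \in `[0, pi *+ 2] -> t \in `[0, pi *+ 2] ->
  (u s - u t) ^+ 2 <= e ^+ 2 * (8 * (1 - cos (s - t))).
Proof.
move=> uper du ue; wlog ts : s t / t <= s.
  move=> wlg sI tI; have [ts|/ltW st] := leP t s; first exact: wlg.
  by rewrite -[u s - u t]opprB sqrrN -[s - t]opprB cosN; exact: wlg.
rewrite !in_itv/= => /andP[s0 s2] /andP[t0 t2].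
have e0 : 0 <= e.
  by apply: (le_trans (normr_ge0 (u' s))); apply: ue; rewrite in_itv/= s0 s2.
have mv a b : 0 <= a -> b <= pi *+ 2 -> a <= b -> `|u b - u a| <= e * (b - a).
  move=> a0 b2 ab; apply: (mean_value_le ab du) => x; rewrite in_itv/= => /andP[ax xb].
  by apply: ue; rewrite in_itv/= (le_trans a0 ax) (le_trans xb b2).
suff [d [d0 dpi dcos dus]] : exists d, [/\ 0 <= d, d <= pi,
    cos d = cos (s - t) & `|u s - u t| <= e * d].
  rewrite -dcos -(@real_normK _ (u s - u t)) ?num_real//.
  apply: (@le_trans _ _ ((e * d) ^+ 2)).
    by rewrite ler_sqr ?nnegrE ?mulr_ge0.
  by rewrite exprMn ler_wpM2l ?sqr_ge0// cos_chord// ger0_norm.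
have [stpi|stpi] := leP (s - t) pi.
  by exists (s - t); split => //; [rewrite subr_ge0|exact: mv].
exists (pi *+ 2 - (s - t)); split.
- by lra.
- by rewrite mulr2n in s2 t2 *; lra.
- by rewrite addrC cosD2pi cosN.
have := mv s (pi *+ 2) s0 (lexx _) s2; have := mv 0 t (lexx _) t2 t0.
rewrite uper !ler_norml => /andP[h1 h2] /andP[h3 h4].
by apply/andP; split; lra.
Qed.

(** Off the diagonal the squared numerator is at most [16 e^2 (1 - cos (s - t))] and the squared
    denominator equals [2 (1 - cos (s - t))], so the squared kernel is at most [8 e^2]; on the
    diagonal it is at most [2 e^2]. The factor 3 rounds up the square root of 8. *)
Lemma ckernel_bound (R : realType) (h : R -> R[i]) (e s t : R) :
  C1_circle h ->
  (forall t, t \in `[0, pi *+ 2] ->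
    `|complex.Re (dangle h t)| <= e /\ `|complex.Im (dangle h t)| <= e) ->
  s \in `[0, pi *+ 2] -> t \in `[0, pi *+ 2] ->
  `|complex.Re (ckernel h s t)| <= 3 * e /\ `|complex.Im (ckernel h s t)| <= 3 * e.
Proof.
move=> Ch he sI tI; have [h1 h2] := he _ tI.
have e0 : 0 <= e by exact: le_trans h1.
apply: ReIm_le_sqnormc; first by rewrite mulr_ge0.
rewrite /ckernel; case: ifPn => [_|st].
  rewrite sqnormcM sqnormcN.
  have -> : sqnormc (Complex (0 : R) 1) = 1 by rewrite /sqnormc /=; ring.
  by rewrite mul1r; apply: le_trans (sqnormc_bnd h1 h2) _; nra.
have dh := C1_circle_cderive Ch.
have hper : h (pi *+ 2) = h 0 by have [+ _] := Ch => /(_ 0); rewrite add0r.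
have dE : sqnormc (1 - conjc (expi s) * expi t) = 2 * (1 - cos (s - t)).
  have -> : 1 - conjc (expi s) * expi t = conjc (expi s) * (expi s - expi t).
    by rewrite mulrBr [_ * expi s]mulrC expi_mulJ.
  by rewrite sqnormcM sqnormcJ sqnormc_expi mul1r sqnormc_expiB.
have d0 : 0 < 2 * (1 - cos (s - t)).
  rewrite -sqnormc_expiB lt_neqAle sqnormc_ge0 andbT eq_sym sqnormc_eq0.
  by rewrite subr_eq0.
have w0 : 1 - conjc (expi s) * expi t != 0 by rewrite -sqnormc_eq0 dE gt_eqF.
rewrite -(ler_pM2r d0) -[in leLHS]dE -sqnormcM mulfVK//.
have H1 := periodic_lipschitz (congr1 (@complex.Re R) hper)
   (fun x => (dh x).1) (fun x xI => (he x xI).1) sI tI.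
have H2 := periodic_lipschitz (congr1 (@complex.Im R) hper)
   (fun x => (dh x).2) (fun x xI => (he x xI).2) sI tI.
rewrite /sqnormc !ReImE; apply: (le_trans (lerD H1 H2)).
have : 0 <= e ^+ 2 * (1 - cos (s - t)) by rewrite mulr_ge0 ?sqr_ge0//; lra.
by lra.
Qed.

Lemma C1_circle_bound (R : realType) (h : R -> R[i]) (e t : R) :
  C1_circle h ->
  (forall t, t \in `[0, pi *+ 2] ->
    `|complex.Re (dangle h t)| <= e /\ `|complex.Im (dangle h t)| <= e) ->
  t \in `[0, pi *+ 2] ->
  `|complex.Re (h t - h 0)| <= e * (pi *+ 2) /\
  `|complex.Im (h t - h 0)| <= e * (pi *+ 2).
Proof.
move=> Ch he; rewrite in_itv/= => /andP[t0 t2].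
have dh := C1_circle_cderive Ch.
have I x : x \in `[0, t] -> x \in `[0, pi *+ 2].
  by rewrite !in_itv/= => /andP[-> xt]; exact: le_trans t2.
have e0 : 0 <= e.
  by have [|+ _] := he 0; [rewrite in_itv/= lexx (le_trans t0)|exact: le_trans].
have H1 := mean_value_le t0 (fun x => (dh x).1) (fun x xI => (he x (I x xI)).1).
have H2 := mean_value_le t0 (fun x => (dh x).2) (fun x xI => (he x (I x xI)).2).
rewrite !ReImE; rewrite subr0 in H1 H2.
by split; [apply: le_trans H1 _|apply: le_trans H2 _]; exact: ler_wpM2l.
Qed.

(** Boundedness comes from [periodic_modulus] with tolerance 1, comparing each angle with 0 and
    using [1 - cos <= 2]. *)
Lemma dangle_bounded (R : realType) (f : R -> R[i]) : C1_circle f ->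
  exists e, forall t, t \in `[0, pi *+ 2] ->
    `|complex.Re (dangle f t)| <= e /\ `|complex.Im (dangle f t)| <= e.
Proof.
move=> Cf; have [_ [_ [_ [f1 f2]]]] := Cf; have fper := dangle_2pi Cf.
have [C1 [C10 H1]] := periodic_modulus f1 (congr1 (@complex.Re R) fper) ltr01.
have [C2 [C20 H2]] := periodic_modulus f2 (congr1 (@complex.Im R) fper) ltr01.
have I0 : 0 \in `[0, pi *+ 2 :> R] by rewrite in_itv/= lexx mulrn_wge0 ?pi_ge0.
have cos2 (x : R) : 1 - cos x <= 2 by have := cos_geN1 x; lra.
exists (`|complex.Re (dangle f 0)| + 1 + C1 * 2 +
  (`|complex.Im (dangle f 0)| + 1 + C2 * 2)).
move=> t tI.
have K1 := H1 _ _ tI I0; have K2 := H2 _ _ tI I0.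
have L1 := ler_wpM2l C10 (cos2 (t - 0)); have L2 := ler_wpM2l C20 (cos2 (t - 0)).
have M1 := ler_normD (complex.Re (dangle f t) - complex.Re (dangle f 0))
  (complex.Re (dangle f 0)).
have M2 := ler_normD (complex.Im (dangle f t) - complex.Im (dangle f 0))
  (complex.Im (dangle f 0)).
rewrite subrK in M1; rewrite subrK in M2.
have N1 := normr_ge0 (complex.Re (dangle f 0)).
have N2 := normr_ge0 (complex.Im (dangle f 0)).
rewrite -/(complex.Re (dangle f t)) -/(complex.Re (dangle f 0)) in K1.
rewrite -/(complex.Im (dangle f t)) -/(complex.Im (dangle f 0)) in K2.
split; lra.
Qed.

(** * Bounded measurable functions on the circle *)

Lemma measurable_angles (R : realType) : measurable (@angles R).
Proof. exact: measurable_itv. Qed.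

Lemma setTDangles (R : realType) : [set: R] `\` ~` @angles R = @angles R.
Proof. by rewrite setDE setTI setCK. Qed.

Lemma anglesP (R : realType) (t : R) : angles t -> t \in `[0, pi *+ 2].
Proof. by rewrite /angles /= !in_itv/= => /andP[-> /ltW ->]. Qed.

Lemma ae_angles (R : realType) (mu : probability R R) :
  on_circle mu -> {ae mu, forall t, angles t}.
Proof.
move=> mu0; exists (~` @angles R); split => //.
by apply: measurableC; exact: measurable_angles.
Qed.

Lemma bounded_integrable (R : realType) (mu : probability R R) (u : R -> R) (M : R) :
  on_circle mu -> measurable_fun setT u ->
  (forall t, angles t -> `|u t| <= M) ->
  mu.-integrable setT (EFin \o u) /\ `|\int[mu]_(x in setT) u x| <= M.
Proof.
move=> mu0 mf uM; have mA := @measurable_angles R; have mN := measurableC mA.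
have muA : (mu (@angles R) <= 1)%E by exact: probability_le1.
have mfA : measurable_fun (@angles R) u by exact: measurable_funTS.
have mE : measurable_fun [set: R] (fun t => (u t)%:E) by exact/measurable_EFinP.
have iA : mu.-integrable (@angles R) (EFin \o u).
  apply: measurable_bounded_integrable => //.
    by apply: (le_lt_trans muA); exact: ltry.
  exists M; split; first exact: num_real.
  by move=> x Mx t At; apply: (le_trans (uM _ At)); exact: ltW.
have iT : mu.-integrable setT (EFin \o u).
  by apply/(negligible_integrable mN measurableT mE mu0); rewrite setTDangles.
split=> //; rewrite /Rintegral (negligible_integral mN measurableT iT mu0) setTDangles.
apply: (le_trans (le_normr_Rintegral mA iA)).
(* The angle 0 witnesses [0 <= M], which lets a mass at most 1 be absorbed. *)
have M0 : 0 <= M.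
  apply: le_trans (uM 0 _); rewrite // /angles /= in_itv/= lexx /=.
  by rewrite pmulrn_lgt0// pi_gt0.
have iM : mu.-integrable (@angles R) (EFin \o (fun _ : R => M)).
  exact: finite_measure_integrable_cst.
apply: (le_trans (le_Rintegral mA (integrable_norm iA) iM uM)).
rewrite Rintegral_cst// ler_piMr//.
by rewrite -lee_fin fineK// fin_num_measure.
Qed.

(** The infimum of the majorants for [e = 1 / (n + 1)] is measurable, nonnegative and of integral 0,
    hence vanishes almost everywhere, and it dominates [u] almost everywhere. *)
Lemma ae_eq0_small (R : realType) (mu : probability R R) (u : R -> R) :
  (forall t, 0 <= u t) ->
  (forall e, 0 < e -> exists D : R -> R, [/\ measurable_fun setT D,
     forall t, 0 <= D t, (\int[mu]_(t in setT) (D t)%:E <= e%:E)%E &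
     {ae mu, forall t, u t <= D t}]) ->
  {ae mu, forall t, u t = 0}.
Proof.
move=> u0 H.
have [D HD] := choice (fun n : nat => H (n.+1%:R^-1) ltac:(by rewrite invr_gt0)).
(* Index 0 makes the tail infimum run over all [n]. *)
pose G := fun t => einfs (fun n => (D n t)%:E) 0.
have mG : measurable_fun setT G.
  apply: (@measurable_realfun.measurable_fun_einfs _ _ _ _ (fun n t => (D n t)%:E)).
  by move=> n; apply/measurable_EFinP; have [] := HD n.
have G0 t : (0 <= G t)%E.
  apply: le_ereal_inf_tmp => _ [n _ <-]; rewrite lee_fin.
  by have [] := HD n.
have GD n t : (G t <= (D n t)%:E)%E.
  by apply: ereal_inf_lbound; exists n.
have iG : (\int[mu]_(t in setT) `|G t| = 0)%E.
  apply/eqP; rewrite eq_le integral_ge0 ?andbT//.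
  apply/lee_addgt0Pr => e e0; rewrite add0e.
  set n := Num.bound e^-1; have [mD D0 iD _] := HD n.
  apply: (@le_trans _ _ (n.+1%:R^-1)%:E); last first.
    rewrite lee_fin -[leRHS]invrK lef_pV2 ?posrE ?invr_gt0//.
    apply: ltW; apply: (lt_trans (archi_boundP _)); first by rewrite invr_ge0 ltW.
    by rewrite ltr_nat.
  apply: le_trans iD; apply: ge0_le_integral => //.
  - exact: measurableT_comp.
  - exact/measurable_EFinP.
  - by move=> t _; rewrite gee0_abs.
have /(ae_eq_integral_abs mu measurableT mG) aG := iG.
have /ae_foralln aD : forall n, {ae mu, forall t, u t <= D n t}.
  by move=> n; have [] := HD n.
apply: filterS2 aG aD => t /(_ I) Gt uD; apply/eqP; rewrite eq_le u0 andbT.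
rewrite -lee_fin -[leRHS]Gt; apply: le_ereal_inf_tmp => _ [n _ <-].
by rewrite lee_fin.
Qed.

(** * Measurability and boundedness of complex functions, by components *)

Definition cmeas (R : realType) (f : R -> R[i]) : Prop :=
  measurable_fun setT (fun x : R => complex.Re (f x) : R) /\
  measurable_fun setT (fun x : R => complex.Im (f x) : R).

Lemma cmeasD (R : realType) (f g : R -> R[i]) :
  cmeas f -> cmeas g -> cmeas (fun x => f x + g x).
Proof.
move=> [f1 f2] [g1 g2]; split; under eq_fun do rewrite !ReImE;
  exact: measurable_funD.
Qed.

Lemma cmeasM (R : realType) (f g : R -> R[i]) :
  cmeas f -> cmeas g -> cmeas (fun x => f x * g x).
Proof.
move=> [f1 f2] [g1 g2]; split; under eq_fun do rewrite !ReImE.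
  by apply: measurable_funB; exact: measurable_funM.
by apply: measurable_funD; exact: measurable_funM.
Qed.

Lemma cmeas_cst (R : realType) (c : R[i]) : cmeas (fun _ : R => c).
Proof. by split; exact: measurable_cst. Qed.

Lemma cmeasN (R : realType) (f : R -> R[i]) : cmeas f -> cmeas (fun x => - f x).
Proof.
move=> mf; under eq_fun do rewrite -mulN1r.
by apply: cmeasM => //; exact: cmeas_cst.
Qed.

Lemma cmeasJ (R : realType) (f : R -> R[i]) :
  cmeas f -> cmeas (fun x => conjc (f x)).
Proof.
move=> [f1 f2]; split; first by under eq_fun do rewrite ReJ; exact: f1.
by under eq_fun do rewrite ImJ; exact: measurable_funN.
Qed.

Lemma measurable_sqnormc (R : realType) (f : R -> R[i]) :
  cmeas f -> measurable_fun setT (fun x : R => sqnormc (f x) : R).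
Proof.
by move=> [f1 f2]; apply: measurable_funD; exact: measurable_funX.
Qed.

Lemma cmeasV (R : realType) (f : R -> R[i]) : cmeas f -> cmeas (fun x => (f x)^-1).
Proof.
move=> mf; have [f1 f2] := mf.
have mV : measurable_fun setT (fun x : R => (sqnormc (f x))^-1 : R).
  (* The real inverse is measurable as a power with exponent -1; the two also agree at 0, where both
     are 0. *)
  rewrite (_ : (fun x : R => _) = (fun x => sqnormc (f x) `^ (-1))).
    apply: (measurableT_comp (measurable_powR _)); exact: measurable_sqnormc.
  by apply/funext => x; rewrite powR_inv1// sqnormc_ge0.
have E z : z^-1 = conjc z * ((sqnormc z)^-1)%:C%C :> R[i].
  by case: z => a b; apply: complex_ext; rewrite !ReImE /= /sqnormc /=; ring.
under eq_fun do rewrite E.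
by apply: cmeasM; [exact: cmeasJ|split => //; exact: measurable_cst].
Qed.

Lemma cmeas_cderive (R : realType) (f f' : R -> R[i]) : cderive f f' -> cmeas f.
Proof.
by move=> /cderive_continuous[c1 c2]; split; exact: continuous_measurable_fun.
Qed.

Lemma cmeas_expi (R : realType) : cmeas (@expi R).
Proof. exact: cmeas_cderive (@cderive_expi1 R). Qed.

Lemma cmeas_ckernel (R : realType) (f : R -> R[i]) (t : R) :
  cmeas f -> cmeas (fun s => ckernel f s t).
Proof.
move=> mf; have mE : measurable_fun setT (fun s : R => expi s == expi t).
  under eq_fun do rewrite eq_complex.
  have [m1 m2] := @cmeas_expi R.
  by apply: measurable_and; apply: measurable_fun_eqr => //; exact: measurable_cst.
have mq : cmeas (fun s => (f s - f t) / (1 - conjc (expi s) * expi t)).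
  apply: cmeasM.
    by apply: cmeasD => //; exact: cmeas_cst.
  apply/cmeasV/cmeasD; first exact: cmeas_cst.
  apply/cmeasN/cmeasM; last exact: cmeas_cst.
  exact/cmeasJ/cmeas_expi.
have [q1 q2] := mq; split; rewrite /ckernel.
  under eq_fun do rewrite (fun_if (@complex.Re R)).
  by apply: measurable_fun_ifT => //; exact: measurable_cst.
under eq_fun do rewrite (fun_if (@complex.Im R)).
by apply: measurable_fun_ifT => //; exact: measurable_cst.
Qed.

Definition cbounded (R : realType) (M : R) (f : R -> R[i]) : Prop :=
  cmeas f /\ forall t, angles t ->
    `|complex.Re (f t)| <= M /\ `|complex.Im (f t)| <= M.

Lemma cbounded_integrable (R : realType) (mu : probability R R) (M : R) f :
  on_circle mu -> cbounded M f ->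
  mu.-integrable setT (EFin \o (fun x => complex.Re (f x))) /\
  mu.-integrable setT (EFin \o (fun x => complex.Im (f x))).
Proof.
move=> mu0 [[f1 f2] fM]; split.
  by have [] := bounded_integrable mu0 f1 (fun t At => (fM t At).1).
by have [] := bounded_integrable mu0 f2 (fun t At => (fM t At).2).
Qed.

Lemma cbounded_cint (R : realType) (mu : probability R R) (M : R) f :
  on_circle mu -> cbounded M f ->
  `|complex.Re (cint mu f)| <= M /\ `|complex.Im (cint mu f)| <= M.
Proof.
move=> mu0 [[f1 f2] fM]; split.
  by have [] := bounded_integrable mu0 f1 (fun t At => (fM t At).1).
by have [] := bounded_integrable mu0 f2 (fun t At => (fM t At).2).
Qed.

Lemma cbounded_sqnormc (R : realType) (mu : probability R R) (M : R) f :
  on_circle mu -> cbounded M f ->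
  mu.-integrable setT (EFin \o (fun x => sqnormc (f x))) /\
  \int[mu]_(x in setT) sqnormc (f x) <= 2 * M ^+ 2.
Proof.
move=> mu0 [mf fM].
have B t : angles t -> `|sqnormc (f t)| <= 2 * M ^+ 2.
  by move=> /fM[h1 h2]; rewrite ger0_norm ?sqnormc_ge0// sqnormc_bnd.
have [i1 i2] := bounded_integrable mu0 (measurable_sqnormc mf) B.
by split=> //; exact: le_trans (ler_norm _) i2.
Qed.

Lemma cbounded_L2 (R : realType) (mu : probability R R) (M : R) f :
  on_circle mu -> cbounded M f -> L2 mu f.
Proof.
move=> mu0 bf; have [i _] := cbounded_sqnormc mu0 bf.
by case: bf => -[f1 f2] _; split.
Qed.

Lemma cint_lin (R : realType) (mu : probability R R) (M N : R) f g (c : R[i]) :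
  on_circle mu -> cbounded M f -> cbounded N g ->
  cint mu (fun x => f x + c * g x) = cint mu f + c * cint mu g.
Proof.
move=> mu0 /(cbounded_integrable mu0)[f1 f2] /(cbounded_integrable mu0)[g1 g2].
have iZ (k : R) (u : R -> R) : mu.-integrable setT (EFin \o u) ->
    mu.-integrable setT (EFin \o (fun x => k * u x)).
  by move=> iu; apply: (integrableZl measurableT k iu).
have iD (u v : R -> R) : mu.-integrable setT (EFin \o u) ->
    mu.-integrable setT (EFin \o v) ->
    mu.-integrable setT (EFin \o (fun x => u x + v x)).
  by move=> iu iv; apply: (integrableD measurableT iu iv).
have iB (u v : R -> R) : mu.-integrable setT (EFin \o u) ->
    mu.-integrable setT (EFin \o v) ->
    mu.-integrable setT (EFin \o (fun x => u x - v x)).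
  by move=> iu iv; apply: (integrableB measurableT iu iv).
apply: complex_ext; rewrite !ReImE /=; under eq_Rintegral do rewrite !ReImE.
  rewrite RintegralD//; last by apply: iB; exact: iZ.
  by rewrite RintegralB ?RintegralZl//; exact: iZ.
rewrite RintegralD//; last by apply: iD; exact: iZ.
by rewrite RintegralD ?RintegralZl//; exact: iZ.
Qed.

Lemma C1_circle_cbounded (R : realType) (f : R -> R[i]) :
  C1_circle f -> exists M, cbounded M f.
Proof.
move=> Cf; have [e He] := dangle_bounded Cf.
exists (`|complex.Re (f 0)| + `|complex.Im (f 0)| + e * (pi *+ 2)); split.
  exact: cmeas_cderive (C1_circle_cderive Cf).
move=> t /anglesP tI; have [] := C1_circle_bound Cf He tI.
rewrite !ReImE.
have := ler_normD (complex.Re (f t) - complex.Re (f 0)) (complex.Re (f 0)).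
have := ler_normD (complex.Im (f t) - complex.Im (f 0)) (complex.Im (f 0)).
rewrite !subrK.
have := normr_ge0 (complex.Re (f 0)); have := normr_ge0 (complex.Im (f 0)).
by split; lra.
Qed.

Lemma cbounded_ckernel (R : realType) (f : R -> R[i]) (e t : R) : C1_circle f ->
  (forall t, t \in `[0, pi *+ 2] ->
    `|complex.Re (dangle f t)| <= e /\ `|complex.Im (dangle f t)| <= e) ->
  angles t -> cbounded (3 * e) (fun s => ckernel f s t).
Proof.
move=> Cf He At; split.
  exact/cmeas_ckernel/cmeas_cderive/(C1_circle_cderive Cf).
by move=> s As; apply: ckernel_bound => //; exact: anglesP.
Qed.

(** * The representation formula *)

Definition clark_repr (R : realType) (mu : probability R R) (alpha : R[i])
    (f : R -> R[i]) (t : R) : R[i] :=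
  f t + (1 - alpha) * cint mu (fun s => ckernel f s t).

Lemma ckernel_lin (R : realType) (f g : R -> R[i]) (c : R[i]) (s t : R) :
  C1_circle f -> C1_circle g ->
  ckernel (fun x => f x + c * g x) s t = ckernel f s t + c * ckernel g s t.
Proof.
move=> /C1_circle_cderive df /C1_circle_cderive dg; rewrite /ckernel.
by rewrite (cderive_dangle (cderive_lin c df dg)); case: ifP => _; ring.
Qed.

Lemma ckernel_cst (R : realType) (c : R[i]) (s t : R) :
  ckernel (fun _ : R => c) s t = 0.
Proof.
by rewrite /ckernel (cderive_dangle (cderive_cst c)) subrr mulr0 mul0r if_same.
Qed.

(** The floor [k] reduces [s - t] modulo [2 pi] to a remainder in [[0, 2 pi)], which [expi_eq1]
    forces to be 0. *)
Lemma periodic_expi (R : realType) (f : R -> R[i]) (s t : R) :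
  (forall x, f (x + pi *+ 2) = f x) -> expi s = expi t -> f s = f t.
Proof.
move=> fper st; have T0 : 0 < (pi *+ 2 : R) by rewrite pmulrn_lgt0// pi_gt0.
set k := Num.floor ((s - t) / (pi *+ 2)).
have : s - t - k%:~R * (pi *+ 2) = 0.
  apply: expi_eq1.
    have /andP[k1 k2] := floor_itv ((s - t) / (pi *+ 2)).
    rewrite -/k ler_pdivlMr// in k1; rewrite -/k ltr_pdivrMr// intrD mulrDl mul1r in k2.
    by rewrite ger0_norm; lra.
  rewrite expiD expiN expi_2pi_int expiD st expiN expi_mulJ mul1r.
  by apply: complex_ext; rewrite !ReImE ?oppr0.
case: k => n st0; last first.
  have -> : t = s + (pi *+ 2) *+ n.+1.
    by move: st0; rewrite NegzE rmorphN /= -mulr_natl -pmulrn; lra.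
  by rewrite (periodicn fper).
have -> : s = t + (pi *+ 2) *+ n by move: st0; rewrite -mulr_natl -pmulrn; lra.
by rewrite (periodicn fper).
Qed.

(** Write [xi f(xi) - z f(z) = (xi - z) f(xi) + z (f(xi) - f(z))] and note
    [xi - z = xi (1 - conj(xi) z)]. On the diagonal the product rule gives the same identity, with
    [f s = f t] by periodicity. *)
Lemma ckernel_expi (R : realType) (f : R -> R[i]) (s t : R) : C1_circle f ->
  ckernel (fun x => expi x * f x) s t = expi s * f s + expi t * ckernel f s t.
Proof.
move=> Cf; have df := C1_circle_cderive Cf; rewrite /ckernel.
rewrite (cderive_dangle (cderiveM (@cderive_expi1 R) df)).
case: ifPn => [/eqP st|st].
  have -> : f s = f t by apply: periodic_expi st; case: Cf.
  by rewrite st; apply: complex_ext; rewrite !ReImE /=; ring.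
have d0 : 1 - conjc (expi s) * expi t != 0.
  apply: contra st; rewrite subr_eq0 => /eqP /(congr1 (fun z => expi s * z)).
  by rewrite mulr1 mulrA expi_mulJ mul1r => ->.
apply: (mulIf d0); rewrite [RHS]mulrDl -(mulrA (expi t)) !mulfVK//.
have E : expi s * conjc (expi s) = 1 by exact: expi_mulJ.
rewrite mulrBr mulr1 [_ * (conjc _ * _)](_ : _ =
    expi s * conjc (expi s) * (f s * expi t)).
  by rewrite E; ring.
by ring.
Qed.

Lemma clark_repr_lin (R : realType) (mu : probability R R) (alpha c : R[i])
    (f g : R -> R[i]) (t : R) : on_circle mu -> angles t ->
  C1_circle f -> C1_circle g ->
  clark_repr mu alpha (fun x => f x + c * g x) t =
  clark_repr mu alpha f t + c * clark_repr mu alpha g t.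
Proof.
move=> mu0 At Cf Cg; rewrite /clark_repr.
have [a /(fun h => cbounded_ckernel Cf h At) Ka] := dangle_bounded Cf.
have [b /(fun h => cbounded_ckernel Cg h At) Kb] := dangle_bounded Cg.
under (@eq_fun _ _ (fun s => ckernel (fun x => _) s t)) do rewrite ckernel_lin//.
by rewrite (cint_lin c mu0 Ka Kb); ring.
Qed.

Lemma C1_circle_expi (R : realType) (f : R -> R[i]) : C1_circle f ->
  C1_circle (fun t => expi t * f t).
Proof.
move=> Cf; have df := C1_circle_cderive Cf.
have [fper [_ [_ [f1 f2]]]] := Cf.
have [g1 g2] := cderive_continuous df.
have cM (u v : R -> R) : continuous u -> continuous v ->
    continuous (fun t => u t * v t).
  by move=> cu cv t; apply: cvgM; [exact: cu|exact: cv].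
have cD (u v : R -> R) : continuous u -> continuous v ->
    continuous (fun t => u t + v t).
  by move=> cu cv t; apply: cvgD; [exact: cu|exact: cv].
have cB (u v : R -> R) : continuous u -> continuous v ->
    continuous (fun t => u t - v t).
  by move=> cu cv t; apply: cvgB; [exact: cu|exact: cv].
have cc : continuous (@cos R) by exact: continuous_cos.
have cs : continuous (@sin R) by exact: continuous_sin.
apply: (cderive_C1_circle _ (cderiveM (@cderive_expi1 R) df)).
- by move=> t; rewrite fper expiD expi_2pi mulr1.
- have -> : (fun t => complex.Re ('i%C * expi t * f t + expi t * dangle f t)) =
    (fun t => cos t * complex.Re (dangle f t) - sin t * complex.Im (dangle f t)
       - sin t * complex.Re (f t) - cos t * complex.Im (f t)).
    by apply/funext => t; rewrite !ReImE /=; ring.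
  exact: (cB _ _ (cB _ _ (cB _ _ (cM _ _ cc f1) (cM _ _ cs f2)) (cM _ _ cs g1))
    (cM _ _ cc g2)).
- have -> : (fun t => complex.Im ('i%C * expi t * f t + expi t * dangle f t)) =
    (fun t => cos t * complex.Im (dangle f t) + sin t * complex.Re (dangle f t)
       + cos t * complex.Re (f t) - sin t * complex.Im (f t)).
    by apply/funext => t; rewrite !ReImE /=; ring.
  exact: (cB _ _ (cD _ _ (cD _ _ (cM _ _ cc f2) (cM _ _ cs f1)) (cM _ _ cc g1))
    (cM _ _ cs g2)).
Qed.

Lemma clark_repr_expi (R : realType) (mu : probability R R) (alpha : R[i])
    (f : R -> R[i]) (t : R) : on_circle mu -> angles t -> C1_circle f ->
  clark_repr mu alpha (fun x => expi x * f x) t =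
  expi t * clark_repr mu alpha f t + (1 - alpha) * cint mu (fun x => expi x * f x).
Proof.
move=> mu0 At Cf; rewrite /clark_repr.
have [a /(fun h => cbounded_ckernel Cf h At) Ka] := dangle_bounded Cf.
have [b Kb] := C1_circle_cbounded (C1_circle_expi Cf).
under (@eq_fun _ _ (fun s => ckernel (fun x => _) s t)) do rewrite ckernel_expi//.
by rewrite (cint_lin (expi t) mu0 Kb Ka); ring.
Qed.

(** * Comparison of [V] with the representation formula *)

Lemma intertwine_expi (R : realType) (mu mua : probability R R) (alpha : R[i])
    (V : (R -> R[i]) -> R -> R[i]) (f : R -> R[i]) :
  on_circle mu -> on_circle mua -> unitary_L2 mu mua V ->
  (forall f, L2 mu f ->
     {ae mua, forall t, V (Ualpha mu alpha f) t = expi t * V f t}) ->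
  {ae mua, forall t, V (@onec R) t = 1} ->
  C1_circle f ->
  {ae mua, forall t, V (fun x => expi x * f x) t
     - clark_repr mu alpha (fun x => expi x * f x) t
     = expi t * (V f t - clark_repr mu alpha f t)}.
Proof.
move=> mu0 mua0 [_ _ Vlin _ _] VU V1 Cf.
have Cef := C1_circle_expi Cf.
have [a fa] := C1_circle_cbounded Cf; have [b efb] := C1_circle_cbounded Cef.
have L1 : L2 mu (@onec R).
  apply: (@cbounded_L2 _ _ 1) => //; split; first exact: cmeas_cst.
  by move=> t _; rewrite /onec !ReImE normr1 normr0.
(* [U_alpha f = xi f + k], so [V (xi f) = z V f - k]. The term [- k] is exactly the constant in
   [clark_repr_expi]; it cancels in the defect, which is therefore just multiplied by [z]. *)
set k := (alpha - 1) * cint mu (fun x => expi x * f x).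
have := VU f (cbounded_L2 mu0 fa).
have -> : Ualpha mu alpha f = (fun x => expi x * f x + k * onec x).
  apply/funext => x; rewrite /Ualpha /onec mulr1 /k; congr (_ + _ * cint _ _).
  by apply/funext => y; rewrite mulrC.
have Vl := Vlin _ _ k (cbounded_L2 mu0 efb) L1.
have V1A : {ae mua, forall t, V (@onec R) t = 1 /\ angles t}.
  by apply: filterS2 V1 (ae_angles mua0) => t.
move=> Ve; apply: filterS3 Vl Ve V1A => t E1 E2 [E3 At].
rewrite clark_repr_expi// mulrBr -E2 E1 E3 /k; ring.
Qed.

Lemma intertwine_trigpoly (R : realType) (mu mua : probability R R) (alpha : R[i])
    (V : (R -> R[i]) -> R -> R[i]) (p : R -> R[i]) :
  on_circle mu -> on_circle mua -> unitary_L2 mu mua V ->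
  (forall f, L2 mu f ->
     {ae mua, forall t, V (Ualpha mu alpha f) t = expi t * V f t}) ->
  {ae mua, forall t, V (@onec R) t = 1} ->
  trigpoly p -> {ae mua, forall t, V p t = clark_repr mu alpha p t}.
Proof.
move=> mu0 mua0 UV VU V1; have [_ _ Vlin _ _] := UV.
have step k : {ae mua, forall t,
    V (fun x => expi ((k + 1)%:~R * x)) t
      - clark_repr mu alpha (fun x => expi ((k + 1)%:~R * x)) t
    = expi t * (V (fun x => expi (k%:~R * x)) t
      - clark_repr mu alpha (fun x => expi (k%:~R * x)) t)}.
  have -> : (fun x : R => expi ((k + 1)%:~R * x)) =
      (fun x => expi x * expi (k%:~R * x)).
    by apply/funext => x; rewrite -expiD intrD mulrDl mul1r addrC.
  by apply: intertwine_expi => //; exact/C1_circle_trigpoly/trigpoly_expi.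
elim=> [k|f g c tf Hf tg Hg].
  elim: k => [|n|n].
  - have -> : (fun x : R => expi (0%:~R * x)) = @onec R.
      by apply/funext => x; rewrite mul0r expi0.
    apply: filterS V1 => t ->; rewrite /clark_repr /onec.
    under eq_fun do rewrite ckernel_cst.
    have -> : cint mu (fun _ => 0) = 0.
      apply: complex_ext; rewrite /= /Rintegral; under eq_integral do rewrite /=.
        by rewrite integral0.
      by rewrite integral0.
    by rewrite mulr0 addr0.
  - have -> : n.+1 = n%:Z + 1 :> int by lia.
    move=> IH; apply: filterS2 IH (step n) => t -> E.
    by apply/eqP; rewrite -subr_eq0 E subrr mulr0.
  (* Negative frequencies run the recursion backwards: the vanishing defect at [- n] is [z] times
     the one at [- n.+1], and [z] is nonzero. *)
  - move=> IH; have := step (- n.+1%:Z).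
    have -> : - n.+1%:Z + 1 = - n%:Z by lia.
    move=> St; apply: filterS2 IH St => t -> /esym/eqP.
    rewrite subrr mulf_eq0 (negbTE (expi_neq0 _)) /=.
    by rewrite subr_eq0 => /eqP.
have Cf := C1_circle_trigpoly tf; have Cg := C1_circle_trigpoly tg.
have [a fa] := C1_circle_cbounded Cf; have [b gb] := C1_circle_cbounded Cg.
have Vl := Vlin _ _ c (cbounded_L2 mu0 fa) (cbounded_L2 mu0 gb).
have HgA : {ae mua, forall t, V g t = clark_repr mu alpha g t /\ angles t}.
  by apply: filterS2 Hg (ae_angles mua0) => t.
by apply: filterS3 Vl Hf HgA => t -> -> [-> At]; rewrite clark_repr_lin.
Qed.

(** [V] preserves the norm, so a uniform bound on [h] becomes a mean square bound on [V h], the only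
    kind available for [V h]. *)
Lemma unitary_sqnormc (R : realType) (mu mua : probability R R)
    (V : (R -> R[i]) -> R -> R[i]) (M : R) (h : R -> R[i]) :
  on_circle mu -> unitary_L2 mu mua V -> cbounded M h ->
  [/\ measurable_fun setT (fun t : R => sqnormc (V h t) : R),
    mua.-integrable setT (EFin \o (fun t => sqnormc (V h t))) &
    \int[mua]_(t in setT) sqnormc (V h t) <= 2 * M ^+ 2].
Proof.
move=> mu0 [VL _ _ Viso _] hM; have Lh := cbounded_L2 mu0 hM.
have [m1 m2 iV] := VL _ Lh; split => //.
  exact: (@measurable_sqnormc _ (V h)).
have [_] := cbounded_sqnormc mu0 hM; apply: le_trans.
have /(congr1 (@complex.Re R)) := Viso _ Lh; rewrite /ip /cint /= => E.
rewrite le_eqVlt; apply/orP; left; apply/eqP.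
under eq_Rintegral do rewrite sqnormcE.
by rewrite E; apply: eq_Rintegral => x _; rewrite sqnormcE.
Qed.

Theorem theorem2p6 (R : realType) (mu : probability R R) (alpha : R[i])
  (mua : probability R R) (V : (R -> R[i]) -> (R -> R[i])) :
  on_circle mu ->
  `|alpha| = 1 ->
  is_spectral_measure mu mua alpha ->
  unitary_L2 mu mua V ->
  (forall f, L2 mu f ->
     {ae mua, forall t, V (Ualpha mu alpha f) t = expi t * V f t}) ->
  {ae mua, forall t, V (@onec R) t = 1} ->
  forall f : R -> R[i], C1_circle f ->
  {ae mua, forall t,
     V f t = f t + (1 - alpha) * cint mu (fun s => ckernel f s t)}.
Proof.
move=> mu0 _ [mua1 [mua0 _]] UV VU V1 f Cf; have [_ _ Vlin _ _] := UV.
suff : {ae mua, forall t, sqnormc (V f t - clark_repr mu alpha f t) = 0}.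
  by apply: filterS => t /eqP; rewrite sqnormc_eq0 subr_eq0 => /eqP.
apply: ae_eq0_small => [t|eps eps0]; first exact: sqnormc_ge0.
pose S := sqnormc (1 - alpha); have S0 : 0 <= S by exact: sqnormc_ge0.
(* [c1 e^2] bounds the squared formula for [h = f - p], from [|h|^2 <= 2 (2 pi e)^2] and a squared
   kernel integral at most [2 (3 e)^2]. [c2 e^2] bounds the integral of the majorant [D]. *)
pose c1 := 2 * (2 * (pi *+ 2) ^+ 2 + S * (2 * 3 ^+ 2)) : R.
pose c2 := 2 * (2 * (pi *+ 2) ^+ 2) + 2 * c1 : R.
have pi2 : 0 <= (pi *+ 2 : R) ^+ 2 by exact: sqr_ge0.
have pipos : 0 < (pi *+ 2 : R) ^+ 2 by rewrite exprn_gt0// pmulrn_lgt0// pi_gt0.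
have c10 : 0 <= c1 by rewrite /c1; nra.
have c20 : 0 < c2 by rewrite /c2; lra.
(* The cap at 1 gives [e^2 <= e], hence [c2 e^2 <= c2 e <= eps] without a square root. *)
pose e := Num.min 1 (eps / c2).
have e0 : 0 < e by rewrite lt_min ltr01 divr_gt0.
have ee : c2 * e ^+ 2 <= eps.
  have h1 : e <= 1 by rewrite ge_min lexx.
  have h2 : c2 * e <= eps by rewrite mulrC -ler_pdivlMr// ge_min lexx orbT.
  by apply: le_trans h2; rewrite ler_pM2l// expr2 ler_piMr// ltW.
have [p [tp p0 Hp]] := C1_circle_approx Cf e0.
have Cp := C1_circle_trigpoly tp.
pose h := fun t => f t + (-1) * p t.
have Ch : C1_circle h by exact: C1_circle_lin.
have dhE : dangle h = fun t => dangle f t + (-1) * dangle p t.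
  exact/cderive_dangle/cderive_lin/C1_circle_cderive/Cp/C1_circle_cderive.
have Hh t : t \in `[0, pi *+ 2] ->
    `|complex.Re (dangle h t)| <= e /\ `|complex.Im (dangle h t)| <= e.
  by move=> /Hp; rewrite dhE mulN1r.
have h0 : h 0 = 0 by rewrite /h p0 mulN1r subrr.
have bh : cbounded (e * (pi *+ 2)) h.
  split; first exact: cmeas_cderive (C1_circle_cderive Ch).
  by move=> t /anglesP At; have := C1_circle_bound Ch Hh At; rewrite h0 subr0.
have [mVh iVh sVh] := unitary_sqnormc mu0 UV bh.
have clark_repr_h t : angles t -> sqnormc (clark_repr mu alpha h t) <= c1 * e ^+ 2.
  move=> At; apply: (le_trans (sqnormcD_le _ _)); rewrite sqnormcM -/S.
  have [b1 b2] := bh.2 _ At; have s1 := sqnormc_bnd b1 b2.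
  have [k1 k2] := cbounded_cint mu0 (cbounded_ckernel Ch Hh At).
  have s2 := ler_wpM2l S0 (sqnormc_bnd k1 k2).
  by rewrite /c1; move: s1 s2; rewrite !exprMn; lra.
pose D t := 2 * sqnormc (V h t) + 2 * (c1 * e ^+ 2).
have iD1 : mua.-integrable setT (EFin \o (fun t => 2 * sqnormc (V h t))).
  exact: (integrableZl measurableT 2 iVh).
have iD2 : mua.-integrable setT (EFin \o (fun _ : R => 2 * (c1 * e ^+ 2))).
  exact: finite_measure_integrable_cst.
exists D; split.
- by apply: measurable_funD => //; exact: measurable_funM.
- move=> t; rewrite /D; have := sqnormc_ge0 (V h t).
  by have := mulr_ge0 c10 (sqr_ge0 e); lra.
- have iD : mua.-integrable setT (EFin \o D) by
    exact: (integrableD measurableT iD1 iD2).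
  rewrite -[leLHS]fineK; last exact: integrable_fin_num.
  rewrite lee_fin; apply: le_trans ee; rewrite -/(Rintegral mua setT D).
  rewrite RintegralD// RintegralZl// Rintegral_cst// mua1 /= mulr1.
  by rewrite /c2; move: sVh; rewrite exprMn; lra.
have [a fa] := C1_circle_cbounded Cf; have [b pb] := C1_circle_cbounded Cp.
have Vl := Vlin _ _ (-1) (cbounded_L2 mu0 fa) (cbounded_L2 mu0 pb).
have Vp := intertwine_trigpoly mu0 mua0 UV VU V1 tp.
apply: filterS3 Vl Vp (ae_angles mua0) => t E1 E2 At.
(* The defect of [p] vanishes, so [f] and [h] have the same defect. *)
have -> : V f t - clark_repr mu alpha f t = V h t + - clark_repr mu alpha h t.
  by rewrite /h clark_repr_lin// E1 E2; ring.
apply: (le_trans (sqnormcD_le _ _)); rewrite sqnormcN mulrDr lerD2l.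
by rewrite ler_pM2l// clark_repr_h.
Qed.
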